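(* Let $n\ge 3$. (1) The space $P_n(\mathrm{SU}(2))$ of imploded spin-framed $n$-gons modulo $\mathrm{SU}(2)$ and the affine cone $\mathrm{Aff}\,\mathrm{Gr}_2(\mathbb{C}^n)$ are homeomorphic. (2) This homeomorphism induces a homeomorphism between $Q_n(\mathrm{SU}(2))$ and $\mathrm{Gr}_2(\mathbb{C}^n)$. That is, there is a homeomorphism $P_n(\mathrm{SU}(2))\to \mathrm{Aff}\,\mathrm{Gr}_2(\mathbb{C}^n)$ which, restricted to classes of perimeter $1$ and followed by the projection $\mathrm{Aff}\,\mathrm{Gr}_2(\mathbb{C}^n)\setminus\{0\}\to \mathrm{Gr}_2(\mathbb{C}^n)$, descends to a homeomorphism $Q_n(\mathrm{SU}(2))\to\mathrm{Gr}_2(\mathbb{C}^n)$.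
   Context: Let $\epsilon_1=(1,0,0)\in\mathbb{R}^3$ and let $\pi:\mathrm{SU}(2)\to\mathrm{SO}(3,\mathbb{R})$ be a fixed double covering homomorphism mapping the diagonal torus $T_{\mathrm{SU}(2)}$ onto the stabilizer of $\epsilon_1$. An imploded spin-framed vector is an equivalence class of pairs $(F,e)\in \mathrm{SU}(2)\times\mathbb{R}^3$ such that $e=t\,\pi(F)(\epsilon_1)$ for some $t\ge 0$, where $(F_1,0)\sim(F_2,0)$ for all $F_1,F_2\in\mathrm{SU}(2)$ (quotient topology). An imploded spin-framed $n$-gon is an $n$-tuple $((F_1,e_1),\dots,(F_n,e_n))$ of imploded spin-framed vectors with $e_1+\cdots+e_n=0$; the space of these is $\widetilde P_n(\mathrm{SU}(2))$. The group $\mathrm{SU}(2)$ acts by $F\cdot((F_i,e_i))_i=((FF_i,\pi(F)e_i))_i$, and $P_n(\mathrm{SU}(2))=\widetilde P_n(\mathrm{SU}(2))/\mathrm{SU}(2)$. The torus $T_{\mathrm{SU}(2)^n}=(T_{\mathrm{SU}(2)})^n$ acts by right multiplication on frames: $(t_i)_i\cdot((F_i,e_i))_i=((F_it_i,e_i))_i$. The perimeter is $\sum_i\|e_i\|$. $Q_n(\mathrm{SU}(2))$ is the quotient of the subspace of $P_n(\mathrm{SU}(2))$ of classes of perimeter $1$ by the diagonally embedded circle in $T_{\mathrm{SU}(2)^n}$. $\mathrm{Aff}\,\mathrm{Gr}_2(\mathbb{C}^n)\subset\bigwedge^2\mathbb{C}^n$ is the cone of decomposable bivectors, i.e. the affine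 cone over the Grassmannian $\mathrm{Gr}_2(\mathbb{C}^n)$ for the Plücker embedding (with its classical topology). *)

(* Defs.v *)
From HB Require Import structures.
From mathcomp Require Import all_boot all_order all_algebra.
From mathcomp Require Import spectral complex ring.
From mathcomp Require Import all_classical all_reals all_analysis.

Set Implicit Arguments.
Unset Strict Implicit.
Unset Printing Implicit Defensive.

Import Order.TTheory GRing.Theory Num.Theory.
Import numFieldNormedType.Exports.

Local Open Scope classical_set_scope.
Local Open Scope ring_scope.
Local Open Scope complex_scope.
Local Open Scope quotient_scope.
Local Open Scope sesquilinear_scope.

(* The topology of R[i] is the one given by the complex modulus. *)
#[non_forgetful_inheritance]
HB.instance Definition _ (R : realType) := NormedModule.copy R[i] R[i]^o.

Definition set_elt (T : Type) (A : set T) (x : T) (Ax : A x) : A :=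
  exist (fun y => y \in A) x (mem_set Ax).

Section Topology.

Definition homeomorphism (X Y : topologicalType) (h : X -> Y) : Prop :=
  continuous h /\
  exists k : Y -> X, [/\ continuous k, cancel h k & cancel k h].

(* Every point of Y has an open neighbourhood V whose preimage is the disjoint
   union of two open sets, each mapped homeomorphically onto V by f. *)
Definition double_covering (X Y : topologicalType) (f : X -> Y) : Prop :=
  continuous f /\
  forall y : Y, exists (V : set Y) (U : bool -> set X),
    [/\ open V, V y, f @^-1` V = U true `|` U false,
        U true `&` U false = set0 &
        forall b, open (U b) /\
          exists2 h : U b -> V, homeomorphism h &
            forall x : U b, set_val (h x) = f (set_val x)].

End Topology.

Section Groups.
Variable R : realType.

Definition SU2_set : set 'M[R[i]]_2 :=
  [set A | A \is unitarymx /\ \det A = 1].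

Definition SO3_set : set 'M[R]_3 :=
  [set A | A *m A^T = 1%:M /\ \det A = 1].

Definition SU2 : Type := SU2_set.
HB.instance Definition _ := SubChoice.copy SU2 (set_type SU2_set).
HB.instance Definition _ := Topological.copy SU2 (set_type SU2_set).

Definition SO3 : Type := SO3_set.
HB.instance Definition _ := SubChoice.copy SO3 (set_type SO3_set).
HB.instance Definition _ := Topological.copy SO3 (set_type SO3_set).

Definition su2_mx (F : SU2) : 'M[R[i]]_2 := \val F.
Definition so3_mx (A : SO3) : 'M[R]_3 := \val A.

Lemma su2_mx_inj : injective su2_mx. Proof. exact: val_inj. Qed.
Lemma so3_mx_inj : injective so3_mx. Proof. exact: val_inj. Qed.

Lemma su2P (F : SU2) : SU2_set (su2_mx F).
Proof. by have := valP F; rewrite inE. Qed.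

Lemma so3P (A : SO3) : SO3_set (so3_mx A).
Proof. by have := valP A; rewrite inE. Qed.

Definition mk_su2 A (HA : SU2_set A) : SU2 := set_elt HA.
Definition mk_so3 A (HA : SO3_set A) : SO3 := set_elt HA.

Lemma su2_one_subproof : SU2_set 1%:M.
Proof.
by split; [apply/unitarymxP; rewrite trmx1 map_mx1 mulmx1 | rewrite det1].
Qed.

Lemma su2_mul_subproof (A B : SU2) : SU2_set (su2_mx A *m su2_mx B).
Proof.
have [uA dA] := su2P A; have [uB dB] := su2P B.
by split; [exact: mul_unitarymx | rewrite det_mulmx dA dB mulr1].
Qed.

Lemma su2_inv_subproof (A : SU2) : SU2_set ((su2_mx A) ^t*).
Proof.
have [uA dA] := su2P A; split; first by rewrite trmxC_unitary.
by rewrite det_map_mx det_tr dA rmorph1.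
Qed.

Definition su2_one := mk_su2 su2_one_subproof.
Definition su2_mul A B := mk_su2 (su2_mul_subproof A B).
Definition su2_inv A := mk_su2 (su2_inv_subproof A).

Lemma su2_mulA : associative su2_mul.
Proof. by move=> A B C; apply: su2_mx_inj; rewrite /su2_mx /= mulmxA. Qed.
Lemma su2_mul1 : left_id su2_one su2_mul.
Proof. by move=> A; apply: su2_mx_inj; rewrite /su2_mx /= mul1mx. Qed.
Lemma su2_mulr1 : right_id su2_one su2_mul.
Proof. by move=> A; apply: su2_mx_inj; rewrite /su2_mx /= mulmx1. Qed.
Lemma su2_mulV : left_inverse su2_one su2_inv su2_mul.
Proof.
move=> A; apply: su2_mx_inj; rewrite /su2_mx /=; apply: mulmx1C.
by have [/unitarymxP] := su2P A.
Qed.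
Lemma su2_mulrV : right_inverse su2_one su2_inv su2_mul.
Proof.
by move=> A; apply: su2_mx_inj; have [/unitarymxP] := su2P A.
Qed.
HB.instance Definition _ := isGroup.Build SU2
  su2_mulA su2_mul1 su2_mulr1 su2_mulV su2_mulrV.

Lemma so3_one_subproof : SO3_set 1%:M.
Proof. by split; [rewrite trmx1 mulmx1 | rewrite det1]. Qed.

Lemma so3_mul_subproof (A B : SO3) : SO3_set (so3_mx A *m so3_mx B).
Proof.
have [oA dA] := so3P A; have [oB dB] := so3P B.
split; last by rewrite det_mulmx dA dB mulr1.
by rewrite trmx_mul mulmxA -(mulmxA (so3_mx A)) oB mulmx1.
Qed.

Lemma so3_inv_subproof (A : SO3) : SO3_set (so3_mx A)^T.
Proof.
have [oA dA] := so3P A; split; last by rewrite det_tr.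
by rewrite trmxK; apply: mulmx1C.
Qed.

Definition so3_one := mk_so3 so3_one_subproof.
Definition so3_mul A B := mk_so3 (so3_mul_subproof A B).
Definition so3_inv A := mk_so3 (so3_inv_subproof A).

Lemma so3_mulA : associative so3_mul.
Proof. by move=> A B C; apply: so3_mx_inj; rewrite /so3_mx /= mulmxA. Qed.
Lemma so3_mul1 : left_id so3_one so3_mul.
Proof. by move=> A; apply: so3_mx_inj; rewrite /so3_mx /= mul1mx. Qed.
Lemma so3_mulr1 : right_id so3_one so3_mul.
Proof. by move=> A; apply: so3_mx_inj; rewrite /so3_mx /= mulmx1. Qed.
Lemma so3_mulV : left_inverse so3_one so3_inv so3_mul.
Proof.
move=> A; apply: so3_mx_inj; rewrite /so3_mx /=; apply: mulmx1C.
by have [] := so3P A.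
Qed.
Lemma so3_mulrV : right_inverse so3_one so3_inv so3_mul.
Proof. by move=> A; apply: so3_mx_inj; have [] := so3P A. Qed.
HB.instance Definition _ := isGroup.Build SO3
  so3_mulA so3_mul1 so3_mulr1 so3_mulV so3_mulrV.

Lemma su2_mxM (A B : SU2) : su2_mx (A * B)%g = su2_mx A *m su2_mx B.
Proof. by []. Qed.
Lemma so3_mxM (A B : SO3) : so3_mx (A * B)%g = so3_mx A *m so3_mx B.
Proof. by []. Qed.
Lemma so3_mx1 : so3_mx 1%g = 1%:M. Proof. by []. Qed.

Definition torus : set SU2 := [set F | is_diag_mx (su2_mx F)].

Lemma torus1 : torus 1%g.
Proof. exact: (scalar_mx_is_diag 2 1). Qed.

Lemma torusM (s t : SU2) : torus s -> torus t -> torus (s * t)%g.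
Proof.
rewrite /torus /= su2_mxM => /is_diag_mxP ds /is_diag_mxP dt.
apply/is_diag_mxP => i j ij; rewrite mxE big1 // => k _.
have [->|ki] := eqVneq k i; first by rewrite dt // mulr0.
by rewrite ds ?mul0r // eq_sym.
Qed.

Lemma torusV (s : SU2) : torus s -> torus (s^-1)%g.
Proof.
move=> /is_diag_mxP ds; apply/is_diag_mxP => i j ij.
rewrite [LHS](_ : _ = (su2_mx s j i)^*); last by rewrite !mxE.
by rewrite ds ?rmorph0 // eq_sym.
Qed.

Lemma torusP (t : torus) : torus (\val t).
Proof. by have := valP t; rewrite inE. Qed.

Definition eps1 : 'cV[R]_3 := delta_mx 0 0.

(* The library norm on matrices is the sup norm. *)
Definition enorm (e : 'cV[R]_3) : R := Num.sqrt (\sum_i e i 0 ^+ 2).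

Lemma enorm_so3 (A : SO3) e : enorm (so3_mx A *m e) = enorm e.
Proof.
suff H (x : 'cV[R]_3) : \sum_i x i 0 ^+ 2 = (x^T *m x) 0 0.
  rewrite /enorm !H trmx_mul mulmxA -(mulmxA e^T).
  have [oA _] := so3P A.
  by rewrite (mulmx1C oA) mulmx1.
by rewrite mxE; apply: eq_bigr => i _; rewrite mxE expr2.
Qed.

Record spin_cover := SpinCover {
  spin_map :> SU2 -> SO3;
  spin_morph : {morph spin_map : F G / (F * G)%g};
  spin_double_covering : double_covering spin_map;
  spin_torus :
    spin_map @` torus = [set A | so3_mx A *m eps1 = eps1] }.

End Groups.
Arguments torus R : clear implicits.
Arguments eps1 R : clear implicits.

Section Imploded.
Variables (R : realType) (cov : spin_cover R).

Definition rot (F : SU2 R) : 'M[R]_3 := so3_mx (cov F).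

Lemma rotM F G : rot (F * G)%g = rot F *m rot G.
Proof. by rewrite /rot spin_morph. Qed.

Lemma rot1 : rot 1%g = 1%:M.
Proof.
have := spin_morph cov 1%g 1%g; rewrite mul1g => /(congr1 (fun A => (cov 1%g)^-1 * A)%g).
by rewrite mulgA mulVg mul1g /rot => <-.
Qed.

Lemma rot_torus (t : torus R) : rot (\val t) *m eps1 R = eps1 R.
Proof.
have : (cov @` torus R) (cov (\val t)) by exists (\val t) => //; exact: torusP.
by rewrite spin_torus.
Qed.

Definition spin_framed : set (SU2 R * 'cV[R]_3) :=
  [set x | exists2 t : R, 0 <= t & x.2 = t *: (rot x.1 *m eps1 R)].

Definition frame (x : spin_framed) : SU2 R := (\val x).1.
Definition vec (x : spin_framed) : 'cV[R]_3 := (\val x).2.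

Lemma spin_framedP (x : spin_framed) :
  exists2 t : R, 0 <= t & vec x = t *: (rot (frame x) *m eps1 R).
Proof. by have := valP x; rewrite inE. Qed.

Lemma spin_framed_inj (x y : spin_framed) :
  frame x = frame y -> vec x = vec y -> x = y.
Proof.
move=> xy1 xy2; apply: val_inj.
by rewrite [\val x]surjective_pairing [\val y]surjective_pairing; congr pair.
Qed.

Definition implode_rel (x y : spin_framed) : bool :=
  (x == y) || (vec x == 0) && (vec y == 0).

Lemma implode_refl : reflexive implode_rel.
Proof. by move=> x; rewrite /implode_rel eqxx. Qed.
Lemma implode_sym : symmetric implode_rel.
Proof. by move=> x y; rewrite /implode_rel eq_sym andbC. Qed.
Lemma implode_trans : transitive implode_rel.
Proof.
move=> y x z; rewrite /implode_rel.
move=> /predU1P[->//|/andP[x0 y0]] /predU1P[<-|/andP[_ z0]].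
  by rewrite x0 y0 orbT.
by rewrite x0 z0 orbT.
Qed.
Definition implode_equiv := EquivRel implode_rel
  implode_refl implode_sym implode_trans.

Definition imploded : Type := quotient_topology {eq_quot implode_equiv}.
HB.instance Definition _ := Topological.copy imploded
  (quotient_topology {eq_quot implode_equiv}).
HB.instance Definition _ := Quotient.copy imploded
  (quotient_topology {eq_quot implode_equiv}).

Lemma imploded_eqP (x y : spin_framed) :
  reflect (\pi_imploded x = \pi_imploded y) (implode_rel x y).
Proof. exact: (@eqquotP _ _ {eq_quot implode_equiv} x y). Qed.

Definition edge (z : imploded) : 'cV[R]_3 := vec (repr z).

Lemma edge_pi x : edge (\pi_imploded x) = vec x.
Proof.
rewrite /edge.
have /imploded_eqP/predU1P[->//|/andP[/eqP -> /eqP ->//]] :=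
  reprK (\pi_imploded x).
Qed.

Lemma spin_act_subproof (F : SU2 R) (x : spin_framed) :
  spin_framed ((F * frame x)%g, rot F *m vec x).
Proof.
have [t t0 tx] := spin_framedP x; exists t => //=.
by rewrite tx rotM -scalemxAr mulmxA.
Qed.

Definition spin_act (F : SU2 R) (x : spin_framed) : spin_framed :=
  set_elt (spin_act_subproof F x).

Lemma frame_spin_act F x : frame (spin_act F x) = (F * frame x)%g.
Proof. by []. Qed.
Lemma vec_spin_act F x : vec (spin_act F x) = rot F *m vec x.
Proof. by []. Qed.

(* Operations on the quotients are computed on the representative chosen by
   repr; the lemmas named _pi show that any representative can be used. *)
Definition imp_act (F : SU2 R) (z : imploded) : imploded :=
  \pi_imploded (spin_act F (repr z)).

Lemma imp_act_pi F x : imp_act F (\pi_imploded x) = \pi_imploded (spin_act F x).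
Proof.
rewrite /imp_act; apply/imploded_eqP.
have /imploded_eqP/predU1P[->|/andP[/eqP ex /eqP ey]] :=
  reprK (\pi_imploded x); first exact: implode_refl.
by apply/orP; right; rewrite !vec_spin_act ex ey mulmx0 eqxx.
Qed.

Lemma imp_act1 z : imp_act 1%g z = z.
Proof.
elim/quotW: z => x; rewrite imp_act_pi; congr (\pi _).
apply: spin_framed_inj; first by rewrite frame_spin_act mul1g.
by rewrite vec_spin_act rot1 mul1mx.
Qed.

Lemma imp_actM F G z : imp_act (F * G)%g z = imp_act F (imp_act G z).
Proof.
elim/quotW: z => x; rewrite (imp_act_pi G) !imp_act_pi; congr (\pi _).
apply: spin_framed_inj; first by rewrite !frame_spin_act mulgA.
by rewrite !vec_spin_act rotM mulmxA.
Qed.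

Lemma edge_imp_act F z : edge (imp_act F z) = rot F *m edge z.
Proof. by elim/quotW: z => x; rewrite imp_act_pi !edge_pi. Qed.

Lemma frame_act_subproof (t : torus R) (x : spin_framed) :
  spin_framed ((frame x * \val t)%g, vec x).
Proof.
have [s s0 sx] := spin_framedP x; exists s => //=.
by rewrite rotM -mulmxA rot_torus.
Qed.

Definition frame_act (t : torus R) (x : spin_framed) : spin_framed :=
  set_elt (frame_act_subproof t x).

Lemma frame_frame_act t x : frame (frame_act t x) = (frame x * \val t)%g.
Proof. by []. Qed.
Lemma vec_frame_act t x : vec (frame_act t x) = vec x.
Proof. by []. Qed.

Definition imp_frame_act (t : torus R) (z : imploded) : imploded :=
  \pi_imploded (frame_act t (repr z)).

Lemma imp_frame_act_pi t x : imp_frame_act t (\pi_imploded x) = \pi_imploded (frame_act t x).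
Proof.
rewrite /imp_frame_act; apply/imploded_eqP.
have /imploded_eqP/predU1P[->|/andP[/eqP ex /eqP ey]] :=
  reprK (\pi_imploded x); first exact: implode_refl.
by apply/orP; right; rewrite !vec_frame_act ex ey eqxx.
Qed.

Lemma edge_imp_frame_act t z : edge (imp_frame_act t z) = edge z.
Proof. by elim/quotW: z => x; rewrite imp_frame_act_pi !edge_pi. Qed.

Lemma imp_frame_actC t F z :
  imp_frame_act t (imp_act F z) = imp_act F (imp_frame_act t z).
Proof.
elim/quotW: z => x; rewrite (imp_act_pi F) (imp_frame_act_pi t x) imp_frame_act_pi imp_act_pi; congr (\pi _).
apply: spin_framed_inj; last by [].
by rewrite !(frame_frame_act, frame_spin_act) mulgA.
Qed.

Lemma imp_frame_act1 (t : torus R) z :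
  \val t = 1%g -> imp_frame_act t z = z.
Proof.
move=> t1; elim/quotW: z => x; rewrite imp_frame_act_pi; congr (\pi _).
by apply: spin_framed_inj; rewrite // frame_frame_act t1 mulg1.
Qed.

Lemma imp_frame_actM (s t u : torus R) z : \val u = (\val s * \val t)%g ->
  imp_frame_act t (imp_frame_act s z) = imp_frame_act u z.
Proof.
move=> ust; elim/quotW: z => x; rewrite (imp_frame_act_pi s) !imp_frame_act_pi; congr (\pi _).
by apply: spin_framed_inj; rewrite // !frame_frame_act ust mulgA.
Qed.

End Imploded.
Arguments spin_framed {R} cov.

Section Polygons.
Variables (R : realType) (cov : spin_cover R) (n : nat).

Definition Ptilde : set {ptws 'I_n -> imploded cov} :=
  [set z | \sum_i edge (z i) = 0].

Definition side (z : Ptilde) (i : 'I_n) : imploded cov := (\val z) i.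

Lemma PtildeP (z : Ptilde) : \sum_i edge (side z i) = 0.
Proof. by have := valP z; rewrite inE. Qed.

Lemma side_inj (y z : Ptilde) : side y =1 side z -> y = z.
Proof. by move=> yz; apply: val_inj; apply/funext. Qed.

Lemma poly_act_subproof (F : SU2 R) (z : Ptilde) :
  Ptilde (fun i => imp_act F (side z i)).
Proof.
rewrite /Ptilde /=; under eq_bigr do rewrite edge_imp_act.
by rewrite -mulmx_sumr PtildeP mulmx0.
Qed.

Definition poly_act (F : SU2 R) (z : Ptilde) : Ptilde :=
  set_elt (poly_act_subproof F z).

Lemma poly_act1 z : poly_act 1%g z = z.
Proof. by apply: side_inj => i; rewrite [LHS]imp_act1. Qed.

Lemma poly_actM F G z : poly_act (F * G)%g z = poly_act F (poly_act G z).
Proof. by apply: side_inj => i; rewrite [LHS]imp_actM. Qed.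

Definition poly_rel (y z : Ptilde) : bool :=
  `[< exists F : SU2 R, z = poly_act F y >].

Lemma poly_refl : reflexive poly_rel.
Proof. by move=> z; apply/asboolP; exists 1%g; rewrite poly_act1. Qed.
Lemma poly_sym : symmetric poly_rel.
Proof.
have H y z : poly_rel y z -> poly_rel z y.
  move=> /asboolP[F ->]; apply/asboolP; exists F^-1%g.
  by rewrite -poly_actM mulVg poly_act1.
by move=> y z; apply/idP/idP; exact: H.
Qed.
Lemma poly_trans : transitive poly_rel.
Proof.
move=> y x z /asboolP[F ->] /asboolP[G ->]; apply/asboolP.
by exists (G * F)%g; rewrite poly_actM.
Qed.
Definition poly_equiv := EquivRel poly_rel poly_refl poly_sym poly_trans.

Definition Pn : Type := quotient_topology {eq_quot poly_equiv}.
HB.instance Definition _ := Topological.copy Pn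
  (quotient_topology {eq_quot poly_equiv}).
HB.instance Definition _ := Quotient.copy Pn
  (quotient_topology {eq_quot poly_equiv}).

Lemma Pn_eqP (y z : Ptilde) :
  reflect (exists F, z = poly_act F y) (\pi_Pn y == \pi_Pn z).
Proof.
apply: (iffP eqP) => [/(@eqquotP _ _ {eq_quot poly_equiv} y z)/asboolP //|H].
by apply/(@eqquotP _ _ {eq_quot poly_equiv} y z)/asboolP.
Qed.

Definition poly_perimeter (z : Ptilde) : R := \sum_i enorm (edge (side z i)).

Definition perimeter (p : Pn) : R := poly_perimeter (repr p).

Lemma perimeter_pi z : perimeter (\pi_Pn z) = poly_perimeter z.
Proof.
have /eqP/Pn_eqP[F zF] := reprK (\pi_Pn z).
rewrite /perimeter {2}zF /poly_perimeter; apply: eq_bigr => i _.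
by rewrite [edge (side (poly_act _ _) _)]edge_imp_act enorm_so3.
Qed.

Lemma poly_torus_subproof (t : 'I_n -> torus R) (z : Ptilde) :
  Ptilde (fun i => imp_frame_act (t i) (side z i)).
Proof.
rewrite /Ptilde /=; under eq_bigr do rewrite edge_imp_frame_act.
exact: PtildeP.
Qed.

(* An element of the torus of SU(2)^n is a family of n elements of the torus
   of SU(2). *)
Definition poly_torus (t : 'I_n -> torus R) (z : Ptilde) : Ptilde :=
  set_elt (poly_torus_subproof t z).

Definition torus_act (t : 'I_n -> torus R) (p : Pn) : Pn :=
  \pi_Pn (poly_torus t (repr p)).

Lemma torus_act_pi t z : torus_act t (\pi_Pn z) = \pi_Pn (poly_torus t z).
Proof.
have /eqP/Pn_eqP[F zF] := reprK (\pi_Pn z).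
rewrite /torus_act {2}zF; apply/eqP/Pn_eqP; exists F.
by apply: side_inj => i; exact: imp_frame_actC.
Qed.

Definition Pn1 : set Pn := [set p | perimeter p = 1].

Definition circle_rel (p q : Pn1) : bool :=
  `[< exists t : torus R, \val q = torus_act (fun=> t) (\val p) >].

Lemma circle_refl : reflexive circle_rel.
Proof.
move=> p; apply/asboolP; exists (set_elt (torus1 R)).
elim/quotW: (\val p) => z; rewrite torus_act_pi; congr (\pi _).
by apply: side_inj => i; rewrite [RHS]imp_frame_act1.
Qed.
Lemma circle_sym : symmetric circle_rel.
Proof.
have H p q : circle_rel p q -> circle_rel q p.
  move=> /asboolP[t qt]; apply/asboolP.
  exists (set_elt (torusV (torusP t))); rewrite {}qt.
  elim/quotW: (\val p) => z; rewrite (torus_act_pi _ z) !torus_act_pi; congr (\pi _).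
  apply: side_inj => i; rewrite [RHS](@imp_frame_actM _ _ _ _ (set_elt (torus1 R))) /=.
    by rewrite imp_frame_act1.
  by rewrite mulgV.
by move=> p q; apply/idP/idP; exact: H.
Qed.
Lemma circle_trans : transitive circle_rel.
Proof.
move=> q p r /asboolP[s qs] /asboolP[t rt]; apply/asboolP.
exists (set_elt (torusM (torusP s) (torusP t))); rewrite {}rt {}qs.
elim/quotW: (\val p) => z; rewrite (torus_act_pi _ z) !torus_act_pi; congr (\pi _).
by apply: side_inj => i; exact: imp_frame_actM.
Qed.
Definition circle_equiv :=
  EquivRel circle_rel circle_refl circle_sym circle_trans.

Definition Qn : Type := quotient_topology {eq_quot circle_equiv}.
HB.instance Definition _ := Topological.copy Qn
  (quotient_topology {eq_quot circle_equiv}).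
HB.instance Definition _ := Quotient.copy Qn
  (quotient_topology {eq_quot circle_equiv}).

End Polygons.
Arguments Ptilde {R} cov n.
Arguments Pn1 {R} cov n.

Section Grassmannian.
Variables (R : realType) (n : nat).
Local Notation C := R[i].
Implicit Types (u v : 'rV[C]_n) (w : 'M[C]_n) (a b c d : C).

(* The second exterior power of C^n is realized as the space of alternating
   n x n matrices, u /\ v having the Pluecker coordinates u_i v_j - u_j v_i. *)
Definition ext2 : set 'M[C]_n := [set w | w^T = - w].

Definition wedge u v : 'M[C]_n := u^T *m v - v^T *m u.

Lemma wedgeE u v i j : wedge u v i j = u 0 i * v 0 j - u 0 j * v 0 i.
Proof.
by rewrite !mxE !big_ord1 !mxE (mulrC (v 0 i)).
Qed.

Lemma wedge_ext2 u v : ext2 (wedge u v).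
Proof. by rewrite /ext2 /= /wedge linearB /= !trmx_mul !trmxK opprB. Qed.

Lemma wedge_comb a b c d u v :
  wedge (a *: u + b *: v) (c *: u + d *: v) = (a * d - b * c) *: wedge u v.
Proof. by apply/matrixP => i j; rewrite wedgeE [RHS]mxE wedgeE !mxE; ring. Qed.

Lemma wedge_neq0 u v : (wedge u v != 0) = free [:: u; v].
Proof.
rewrite free_cons span_seq1 seq1_free; apply/idP/andP => [uv|[]].
  split; apply: contraNN uv.
    by move=> /vlineP[k ->]; apply/eqP/matrixP => i j; rewrite wedgeE !mxE; ring.
  by move=> /eqP ->; apply/eqP/matrixP => i j; rewrite wedgeE !mxE; ring.
move=> + v0; apply: contraNN => /eqP uv.
have /rV0Pn[j vj] := v0.
apply/vlineP; exists (u 0 j / v 0 j); apply/rowP => i; rewrite mxE.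
have /matrixP/(_ i j) := uv; rewrite wedgeE mxE => /eqP.
by rewrite subr_eq0 => /eqP H; apply: (mulIf vj); rewrite H mulrAC mulfVK.
Qed.

Definition AffGr2 : set 'M[C]_n := [set w | exists u v, w = wedge u v].

Lemma AffGr2_ext2 : AffGr2 `<=` ext2.
Proof. by move=> w [u [v ->]]; exact: wedge_ext2. Qed.

Definition ext2_star : set 'M[C]_n := [set w | ext2 w /\ w != 0].

Definition line_rel (w w' : ext2_star) : bool :=
  `[< exists2 c : C, c != 0 & \val w' = c *: \val w >].

Lemma line_refl : reflexive line_rel.
Proof.
by move=> w; apply/asboolP; exists 1; rewrite ?oner_neq0 // scale1r.
Qed.
Lemma line_sym : symmetric line_rel.
Proof.
have H x y : line_rel x y -> line_rel y x.
  move=> /asboolP[c c0 yE]; apply/asboolP; exists c^-1; first by rewrite invr_eq0.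
  by rewrite yE scalerA mulVf // scale1r.
by move=> x y; apply/idP/idP; exact: H.
Qed.
Lemma line_trans : transitive line_rel.
Proof.
move=> y x z /asboolP[c c0 yE] /asboolP[d d0 zE]; apply/asboolP.
by exists (d * c); rewrite ?mulf_neq0 // zE yE scalerA.
Qed.
Definition line_equiv := EquivRel line_rel line_refl line_sym line_trans.

Definition Pext2 : Type := quotient_topology {eq_quot line_equiv}.
HB.instance Definition _ := Topological.copy Pext2
  (quotient_topology {eq_quot line_equiv}).
HB.instance Definition _ := Quotient.copy Pext2
  (quotient_topology {eq_quot line_equiv}).

Definition plane_set : set {vspace 'rV[C]_n} := [set W | \dim W = 2%N].

Lemma plane_dim (W : plane_set) : \dim (\val W) = 2%N.
Proof. by have := valP W; rewrite inE. Qed.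

Definition plane_fst (W : plane_set) : 'rV[C]_n := (vbasis (\val W))`_0.
Definition plane_snd (W : plane_set) : 'rV[C]_n := (vbasis (\val W))`_1.

Lemma plane_basis (W : plane_set) :
  vbasis (\val W) = [:: plane_fst W; plane_snd W] :> seq _.
Proof.
rewrite /plane_fst /plane_snd; have := plane_dim W.
case: (vbasis _) => s /= /eqP; move=> ss d2; move: ss; rewrite d2.
by case: s => [|x [|y [|]]].
Qed.

Lemma plane_ext2_star (W : plane_set) :
  ext2_star (wedge (plane_fst W) (plane_snd W)).
Proof.
split; first exact: wedge_ext2.
by have := basis_free (vbasisP (\val W)); rewrite plane_basis wedge_neq0.
Qed.

(* By pluckerE below, any basis of the plane gives the same line. *)
Definition plucker (W : plane_set) : Pext2 :=
  \pi_Pext2 (set_elt (plane_ext2_star W)).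

(* The classical topology of the Grassmannian is the one for which the
   Pluecker embedding is a homeomorphism onto its image. *)
Definition Gr2 : Type := initial_topology plucker.
HB.instance Definition _ := Topological.copy Gr2 (initial_topology plucker).

Definition plane_of (W : Gr2) : {vspace 'rV[C]_n} := \val (W : plane_set).

Lemma pluckerE (W : plane_set) (w : ext2_star) u v :
  \val W = <<[:: u; v]>>%VS -> \val w = wedge u v -> plucker W = \pi_Pext2 w.
Proof.
move=> Wuv wE; apply/eqP; rewrite eq_sym; apply/eqP.
apply/(@eqquotP _ _ {eq_quot line_equiv})/asboolP.
have mem x : x \in \val W -> exists a b, x = a *: u + b *: v.
  rewrite Wuv span_cons span_seq1 => /memv_addP[_ /vlineP[a ->]].
  by move=> [_ /vlineP[b ->] ->]; exists a, b.
have [a [b fE]] : exists a b, plane_fst W = a *: u + b *: v.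
  by apply: mem; apply: vbasis_mem; rewrite memtE plane_basis !inE eqxx.
have [c [d sE]] : exists c d, plane_snd W = c *: u + d *: v.
  by apply: mem; apply: vbasis_mem; rewrite memtE plane_basis !inE eqxx orbT.
exists (a * d - b * c) => /=; last by rewrite fE sE wedge_comb wE.
have [_] := plane_ext2_star W; rewrite fE sE wedge_comb.
by apply: contraNneq => ->; rewrite scale0r.
Qed.

Definition AffGr2_star : set 'M[C]_n := [set w | AffGr2 w /\ w != 0].

Lemma AffGr2_starP (w : AffGr2_star) : exists uv, \val w = wedge uv.1 uv.2.
Proof. by have := valP w; rewrite inE => -[[u [v ->]] _]; exists (u, v). Qed.

Lemma AffGr2_star_neq0 (w : AffGr2_star) : \val w != 0.
Proof. by have := valP w; rewrite inE => -[]. Qed.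

Lemma cone_proj_subproof (w : AffGr2_star) :
  plane_set <<[:: (sval (cid (AffGr2_starP w))).1;
                  (sval (cid (AffGr2_starP w))).2]>>%VS.
Proof.
case: cid => -[u v] /= wE; apply/eqP; rewrite -[_ == _]/(free [:: u; v]).
by rewrite -wedge_neq0 -wE AffGr2_star_neq0.
Qed.

(* By cone_projE below, the plane does not depend on the chosen u and v. *)
Definition cone_proj (w : AffGr2_star) : Gr2 :=
  set_elt (cone_proj_subproof w).

Lemma wedge_span u v u' v' : wedge u v != 0 -> wedge u v = wedge u' v' ->
  (<<[:: u; v]>> <= <<[:: u'; v']>>)%VS.
Proof.
move=> w0 wE.
have rowE x y k : row k (wedge x y) = x 0 k *: y - y 0 k *: x.
  by apply/rowP => j; rewrite mxE wedgeE !mxE (mulrC (x 0 j)).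
have rowin k : row k (wedge u v) \in <<[:: u'; v']>>%VS.
  by rewrite wE rowE rpredB // rpredZ // memv_span // !inE eqxx ?orbT.
have [i [j wij]] : exists i j, wedge u v i j != 0.
  move: w0 => /eqP w0; apply: contrapT => H; apply: w0; apply/matrixP => i j.
  by rewrite [RHS]mxE; apply/eqP; apply: contrapT => /negP Hij; apply: H; exists i, j.
have vE : v = (wedge u v i j)^-1 *:
    (v 0 j *: row i (wedge u v) - v 0 i *: row j (wedge u v)).
  rewrite -[LHS](scalerK wij); congr (_ *: _); rewrite !rowE wedgeE.
  by apply/rowP => k; rewrite !mxE; ring.
have uE : u = (wedge u v i j)^-1 *:
    (u 0 j *: row i (wedge u v) - u 0 i *: row j (wedge u v)).
  rewrite -[LHS](scalerK wij); congr (_ *: _); rewrite !rowE wedgeE.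
  by apply/rowP => k; rewrite !mxE; ring.
apply/span_subvP => x; rewrite !inE => /orP[] /eqP ->.
  by rewrite uE rpredZ // rpredB // rpredZ.
by rewrite vE rpredZ // rpredB // rpredZ.
Qed.

Lemma cone_projE (w : AffGr2_star) u v :
  \val w = wedge u v -> plane_of (cone_proj w) = <<[:: u; v]>>%VS.
Proof.
move=> wE; rewrite /plane_of /cone_proj /=.
case: cid => -[u' v'] /= wE'.
have w0 := AffGr2_star_neq0 w.
by apply: subv_anti; apply/andP; split; apply: wedge_span;
  rewrite -?wE -?wE'.
Qed.

End Grassmannian.
Arguments AffGr2 R n : clear implicits.
Arguments AffGr2_star R n : clear implicits.

(* Main.v *)
Require Import Defs.
From HB Require Import structures.
From mathcomp Require Import all_boot all_order all_algebra.
From mathcomp Require Import spectral complex ring lra.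
From mathcomp Require Import all_classical all_reals all_analysis.
Require Import Defs.

(** A spin-framed vector [(F, e)] is determined, up to the implosion, by the
    spinor [sqrt |e| F (1,0)] in C^2; writing the spinors of the sides of a
    polygon as the columns of a 2 x n matrix with rows [u] and [v], the closing
    condition says that [u] and [v] are orthogonal and of the same norm, and
    SU(2) acts by left multiplication.  The homeomorphism sends the polygon to
    the bivector [u /\ v] ([bivector]).

    The closing condition has to be read off from an arbitrary double covering
    [cov], and only there does the choice of the covering matter.  Let
    [c F = <cov(F) eps1, eps1>] ([zonal]).  The kernel of [cov] is {1, -1}, so
    the element [diag(i, -i)] of the torus goes to the half-turn about [eps1],
    and averaging over it gives [c (F G) + c (F diag(i, -i) G) = 2 c(F) c(G)]
    ([zonal_mean]).  Along the one-parameter group of real rotations this is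
    the functional equation of d'Alembert, and the kernel leaves no other
    continuous solution than [cos (2 a)] ([dAlembert_cos]); by the Cartan
    decomposition [c F = 2 |F00|^2 - 1] ([zonalE]).  Thus the sides of a polygon
    have the Gram matrix of the Hopf vectors of their spinors ([edge_dot],
    [hopf_dot]), and two families with the same Gram matrix have a zero sum
    simultaneously ([closedP]).

    That [bivector] is a bijection is linear algebra.  If two balanced pairs
    have the same bivector, the unimodular matrix relating them is unitary
    ([balanced_unique]), and Gram-Schmidt makes any pair balanced without
    changing its bivector ([balanced_exists]).  For a balanced pair the
    bivector has squared norm half the square of the perimeter, so
    [bivector] is proper; a proper continuous bijection onto a Hausdorff space
    is a homeomorphism ([homeomorphism_proper]).

    The circle multiplies bivectors by squares of unit complex numbers, that
    is, by all unit complex numbers, so the classes of perimeter 1 modulo the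
    circle are the complex lines of the cone ([polygon_plane_eqP]).  The induced
    map is a continuous bijection from a compact space to the Grassmannian,
    which is Hausdorff ([Gr2_hausdorff]). *)

Set Implicit Arguments.
Unset Strict Implicit.
Unset Printing Implicit Defensive.

Import Order.TTheory GRing.Theory Num.Theory.
Import numFieldNormedType.Exports.

Local Open Scope classical_set_scope.
Local Open Scope ring_scope.
Local Open Scope complex_scope.
Local Open Scope quotient_scope.

Local Notation Re := complex.Re.
Local Notation Im := complex.Im.

(** * Topological preliminaries *)

(** Near [y] the inverse map takes values in the compact set [K], and the part
    of [K] outside a neighbourhood of the preimage of [y] has a closed image
    that misses [y]. *)
Lemma homeomorphism_proper (X Y : topologicalType) (f : X -> Y) :
  continuous f -> injective f -> (forall y, exists x, f x = y) ->
  hausdorff_space Y ->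
  (forall y : Y, exists2 V : set Y, nbhs y V &
     exists2 K : set X, compact K & f @^-1` V `<=` K) ->
  homeomorphism f.
Proof.
move=> fc finj fsurj hY proper; split => //.
pose k y := sval (cid (fsurj y)).
have fk : cancel k f by move=> y; rewrite /k; case: cid.
exists k; split => //; last by move=> x; apply: finj; rewrite fk.
move=> y B /=; rewrite nbhs_simpl nbhsE => -[W [oW Wky] WB].
have [V yV [K cK VK]] := proper y.
have cfKO : closed (f @` (K `&` ~` W)).
  apply: compact_closed => //; apply: continuous_compact.
    exact: continuous_subspaceT.
  by apply: compact_closedI => //; exact: open_closedC.
have yfKO : nbhs y (~` (f @` (K `&` ~` W) : set Y)).
  apply: open_nbhs_nbhs; split; first exact: closed_openC.
  move=> [x [_ nWx] fxy]; apply: nWx.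
  by rewrite -(finj _ _ (etrans (fk y) (esym fxy))).
apply: filterS (filterI yV yfKO) => z [Vz nz]; apply: WB.
apply: contrapT => nW; apply: nz; exists (k z) => //; split => //.
by apply: VK; rewrite /preimage /= fk.
Qed.

(** The subspace topology on a set type has no other open sets than the traces,
    so cluster points can be sought in the ambient space. *)
Lemma compact_set_type (X : topologicalType) (A : set X) (B : set A) :
  compact (set_val @` B) -> compact B.
Proof.
move=> cB F PF FB.
have [|x [[b Bb bx] clx]] := cB (set_val @ F).
  have FB' : F (set_val @^-1` (set_val @` B)) by apply: filterS FB => a Ba; exists a.
  exact: FB'.
exists b; split => // P Q FP; rewrite nbhsE => -[_ [[W oW <-] Wb] WQ].
have FP' : F (set_val @^-1` (set_val @` P)) by apply: filterS FP => a Pa; exists a.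
have Wx : nbhs x W by apply: open_nbhs_nbhs; split => //; rewrite -bx.
have [y [[a Pa ay] Wy]] := clx (set_val @` P) W FP' Wx.
by exists a; split => //; apply: WQ; rewrite /preimage /= ay.
Qed.

Lemma hausdorff_separated (T : topologicalType) (V : topologicalType) :
  hausdorff_space V ->
  (forall x y : T, x <> y -> exists2 f : T -> V, continuous f & f x <> f y) ->
  hausdorff_space T.
Proof.
move=> hV sep x y clxy; apply: contrapT => /sep[f fc]; apply; apply: hV.
move=> A B fxA fyB.
have [z [Az Bz]] := clxy (f @^-1` A) (f @^-1` B) (fc _ _ fxA) (fc _ _ fyB).
by exists (f z).
Qed.

Lemma set_val_continuous (X : topologicalType) (A : set X) :
  continuous (set_val : A -> X).
Proof. exact: initial_continuous. Qed.

Lemma continuous_set_type (X Y : topologicalType) (A : set Y) (f : X -> A) :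
  continuous (fun x => set_val (f x)) -> continuous f.
Proof. exact: continuous_comp_initial. Qed.

Lemma eval_continuous (Y : topologicalType) (I : eqType) (i : I) :
  continuous (fun y : {ptws I -> Y} => y i).
Proof. exact: (@proj_continuous I (fun=> Y) i). Qed.

Lemma continuous_pair (X Y Z : topologicalType) (f : X -> Y) (g : X -> Z) :
  continuous f -> continuous g -> continuous (fun x => (f x, g x)).
Proof. by move=> fc gc x; apply: cvg_pair; [exact: fc | exact: gc]. Qed.

Lemma continuous_sum (X : topologicalType) (K : numFieldType)
    (V : normedModType K) I (s : seq I) (f : I -> X -> V) :
  (forall i, continuous (f i)) -> continuous (fun x => \sum_(i <- s) f i x).
Proof.
move=> fc; elim: s => [|i s IH] x.
  by under eq_fun do rewrite big_nil; exact: cvg_cst.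
under eq_fun do rewrite big_cons.
by apply: cvgD; [exact: fc | exact: IH].
Qed.

Lemma continuous_mx (X T : topologicalType) m n (f : X -> 'M[T]_(m, n)) :
  (forall i j, continuous (fun x => f x i j)) -> continuous f.
Proof.
move=> fc x A [P Pfx PA].
have H : \forall z \near x, forall i j, P i j (f z i j).
  have H2 i : \forall z \near x, forall j, P i j (f z i j).
    by apply: filter_forall => j; exact: fc (Pfx i j).
  exact: filter_forall.
by apply: filterS H => z Hz; exact: PA.
Qed.

Lemma continuous_entry (T : topologicalType) m n i j :
  continuous (fun M : 'M[T]_(m, n) => M i j).
Proof.
move=> M A MA; exists (fun i' j' => [set z | (i' = i) -> (j' = j) -> A z]).
  move=> i' j'.
  have [->|ii] := eqVneq i' i; last first.
    by apply: filterE => z /= e; rewrite e eqxx in ii.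
  have [->|jj] := eqVneq j' j; last first.
    by apply: filterE => z /= _ e; rewrite e eqxx in jj.
  by move: MA; apply: filterS => z Az _ _.
by move=> N NA; apply: (NA i j).
Qed.

Section ComplexTopology.
Variable R : realType.
Local Notation C := R[i].

Lemma cplx_continuousM (X : topologicalType) (f g : X -> C) :
  continuous f -> continuous g -> continuous (fun x => f x * g x).
Proof. by move=> fc gc x; apply: (@cvgM C); [exact: fc | exact: gc]. Qed.

Lemma cplx_continuousD (X : topologicalType) (f g : X -> C) :
  continuous f -> continuous g -> continuous (fun x => f x + g x).
Proof. by move=> fc gc x; apply: cvgD; [exact: fc | exact: gc]. Qed.

Lemma cplx_continuousN (X : topologicalType) (f : X -> C) :
  continuous f -> continuous (fun x => - f x).
Proof. by move=> fc x; apply: cvgN; exact: fc. Qed.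

Lemma Re_continuous : continuous (fun z : C => Re z).
Proof.
move=> z A /nbhs_ballP[e e0 eA]; apply/nbhs_ballP; exists e%:C.
  by rewrite /= ltcR.
move=> w; rewrite /ball /= => zw; apply: eA; rewrite /ball /= -ltcR.
apply: le_lt_trans zw; rewrite -raddfB /=; exact: normc_ge_Re.
Qed.

Lemma Im_continuous : continuous (fun z : C => Im z).
Proof.
move=> z A /nbhs_ballP[e e0 eA]; apply/nbhs_ballP; exists e%:C.
  by rewrite /= ltcR.
move=> w; rewrite /ball /= => zw; apply: eA; rewrite /ball /= -ltcR.
apply: le_lt_trans zw.
rewrite -raddfB /= normc_def lecR -sqrtr_sqr ler_wsqrtr // lerDr.
exact: sqr_ge0.
Qed.

Lemma complex_continuous (X : topologicalType) (f g : X -> R) :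
  continuous f -> continuous g -> continuous (fun x => f x +i* g x : C).
Proof.
move=> fc gc x A /nbhs_ballP[e]; rewrite /= ltcE /= => /andP[/eqP e0 e1] eA.
have ee : e = (Re e)%:C by move: e0; case: (e) => a b /= ->.
have e2 : 0 < Re e / 2 by apply: divr_gt0.
have H1 : \forall y \near x, ball (f x) (Re e / 2) (f y).
  exact: fc x _ (nbhsx_ballx _ _ e2).
have H2 : \forall y \near x, ball (g x) (Re e / 2) (g y).
  exact: gc x _ (nbhsx_ballx _ _ e2).
apply: filterS (filterI H1 H2) => y [fy gy]; apply: eA; move: fy gy.
rewrite /ball /= => fy gy; rewrite ee.
rewrite [X in `|X|](_ : _ = (f x - f y)%:C + 'i%C * (g x - g y)%:C); last by simpc.
apply: le_lt_trans (ler_normD _ _) _.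
rewrite normrM !normc_def /= !expr0n !addr0 !add0r expr1n !sqrtr_sqr sqrtr1 mul1r.
by rewrite -rmorphD ltcR /= [ltRHS]splitr ltrD.
Qed.

Lemma conjc_continuous (X : topologicalType) (f : X -> C) :
  continuous f -> continuous (fun x => (f x)^*%C).
Proof.
move=> fc.
have -> : (fun x => (f x)^*%C) = (fun x => Re (f x) +i* - Im (f x)).
  by apply/funext => x; case: (f x).
apply: complex_continuous => x.
  by apply: continuous_comp; [exact: fc | exact: Re_continuous].
apply: cvgN; by apply: continuous_comp; [exact: fc | exact: Im_continuous].
Qed.

Lemma realc_continuous (X : topologicalType) (f : X -> R) :
  continuous f -> continuous (fun x => (f x)%:C : C).
Proof. by move=> fc; apply: complex_continuous => // x; exact: cvg_cst. Qed.

Lemma complex_hausdorff : hausdorff_space C.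
Proof. exact: (@norm_hausdorff C C). Qed.

End ComplexTopology.

Lemma mx_hausdorff (T : topologicalType) m n :
  hausdorff_space T -> hausdorff_space 'M[T]_(m, n).
Proof.
move=> hT; apply: (hausdorff_separated hT) => A B AB.
suff [i [j ij]] : exists i j, A i j <> B i j.
  by exists (fun M : 'M[T]_(m, n) => M i j) => //; exact: continuous_entry.
apply: contrapT => H; apply: AB; apply/matrixP => i j.
by apply: contrapT => ij; apply: H; exists i, j.
Qed.

Lemma set_type_hausdorff (T : topologicalType) (A : set T) :
  hausdorff_space T -> hausdorff_space A.
Proof.
move=> hT; apply: (hausdorff_separated hT) => a b ab.
exists set_val; first exact: set_val_continuous.
by move=> /val_inj.
Qed.

Lemma compact_ptws (T : topologicalType) (I : eqType) (K : set T) :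
  compact K -> compact [set f : {ptws I -> T} | forall i, K (f i)].
Proof. by move=> cK; exact: (@tychonoff I (fun=> T) (fun=> K)). Qed.

(** Over [y] each of the two sheets contributes exactly one point. *)
Lemma double_covering_fibre (X Y : topologicalType) (f : X -> Y) (y : Y) :
  double_covering f -> exists x1 x2, [/\ x1 <> x2, f x1 = y, f x2 = y &
    forall x, f x = y -> x = x1 \/ x = x2].
Proof.
move=> [_ /(_ y)[V [U [_ Vy fV UU fU]]]].
have sheet b : exists x,
    [/\ U b x, f x = y & forall x', U b x' -> f x' = y -> x' = x].
  have [_ [h [_ [k [_ hk kh]]] hf]] := fU b.
  exists (set_val (k (set_elt Vy))); split.
  - exact: set_valP.
  - by rewrite -hf kh.
  move=> x' Ux' fx'; rewrite -[x']/(set_val (set_elt Ux')); congr (set_val _).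
  rewrite -[LHS]hk; congr k; apply: val_inj; rewrite /=.
  by have := hf (set_elt Ux'); rewrite !set_valE /= => ->.
have [x1 [U1 f1 u1]] := sheet true; have [x2 [U2 f2 u2]] := sheet false.
exists x1, x2; split => //.
  move=> x12; have : (U true `&` U false) x1 by split => //; rewrite x12.
  by rewrite UU.
move=> x fx; have : (f @^-1` V) x by rewrite /preimage /= fx.
by rewrite fV => -[Ux|Ux]; [left; apply: u1 | right; apply: u2].
Qed.

(** * D'Alembert's functional equation *)

Section DAlembert.
Variables (R : realType) (C : R -> R).
Hypothesis C_cont : continuous C.
Hypothesis C_dAlembert : forall a b, C (a + b) + C (b - a) = 2 * C a * C b.
Hypothesis C0 : C 0 = 1.
Hypothesis Cpi : C pi = 1.
Hypothesis C_neq1 : forall a, 0 < a < pi -> C a != 1.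

Let C_double a : C (a *+ 2) = 2 * C a ^+ 2 - 1.
Proof. by have := C_dAlembert a a; rewrite subrr C0 mulr2n => H; lra. Qed.

Let C_ge0 a : 0 <= a <= pi / 4 -> 0 <= C a.
Proof.
move=> /andP[a0 api]; rewrite leNgt; apply/negP => Ca.
have [| |c] := @IVT R C 0 a 0 a0.
- exact: continuous_subspaceT.
- by rewrite C0 ge_min le_max (ltW Ca) ler01 orbT.
rewrite in_itv /= => /andP[c0 ca] Cc.
have cn0 : c != 0 by apply/eqP => c0'; move: Cc; rewrite c0' C0; lra.
have cna : c != a by apply/eqP => c0'; move: Cc; rewrite c0'; lra.
have c4 : 0 < c *+ 2 *+ 2 < pi.
  have : 0 < c by rewrite lt_neqAle eq_sym cn0.
  have : c < a by rewrite lt_neqAle cna.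
  by rewrite !mulr2n => *; lra.
by move: (C_neq1 c4); rewrite !C_double Cc => /eqP; lra.
Qed.

Let C_dyadic k : C (pi / 2 / 2 ^+ k) = cos (pi / 2 / 2 ^+ k *+ 2).
Proof.
have pi0 := @pi_gt0 R.
elim: k => [|k IH].
  rewrite expr0 divr1 [X in cos X](_ : _ = pi); last by rewrite mulr2n -splitr.
  have := C_double (pi / 2).
  rewrite [X in C X](_ : _ = pi); last by rewrite mulr2n -splitr.
  rewrite Cpi cospi => H.
  have Cn1 : C (pi / 2) != 1 by apply: C_neq1; lra.
  have /eqP : (C (pi / 2) - 1) * (C (pi / 2) + 1) = 0 by lra.
  by rewrite mulf_eq0 subr_eq0 (negPf Cn1) /= => /eqP; lra.
set x := pi / 2 / 2 ^+ k.+1.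
have xx : pi / 2 / 2 ^+ k = x *+ 2.
  by rewrite /x exprS invfM mulrCA [2^-1 * _]mulrC [RHS]mulr2n -splitr.
have x0 : 0 <= x by rewrite divr_ge0 ?exprn_ge0 // divr_ge0 // ltW.
have x1 : x <= pi / 4.
  rewrite /x exprS invfM mulrA ler_pdivrMr ?exprn_gt0 //.
  have : 1 <= 2 ^+ k :> R by rewrite exprn_ege1 // ler1n.
  by move=> h; nra.
rewrite xx C_double [cos (_ *+ 2)]cos_mulr2n in IH.
apply/eqP; rewrite -(@eqrXn2 _ 2) //; first by apply/eqP; lra.
  by apply: C_ge0; rewrite x0.
by apply: cos_ge0_pihalf; rewrite [x *+ 2]mulr2n; lra.
Qed.

Let C_mul x : C x = cos (x *+ 2) -> forall m, C (x *+ m) = cos (x *+ m *+ 2).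
Proof.
move=> Cx m; suff: C (x *+ m) = cos (x *+ m *+ 2) /\
    C (x *+ m.+1) = cos (x *+ m.+1 *+ 2) by case.
elim: m => [|m [IH1 IH2]]; first by rewrite !mulr0n mul0rn C0 cos0 mulr1n.
split => //.
have := C_dAlembert x (x *+ m.+1).
have -> : x *+ m.+1 - x = x *+ m by rewrite mulrSr addrK.
rewrite IH1 IH2 Cx -mulrS => H.
have -> : x *+ m.+2 *+ 2 = x *+ 2 + x *+ m.+1 *+ 2.
  by rewrite [x *+ m.+2]mulrS mulrnDl.
have E : x *+ m *+ 2 = x *+ m.+1 *+ 2 - x *+ 2.
  by rewrite [x *+ m.+1]mulrS mulrnDl [x *+ 2 + _]addrC addrK.
rewrite E cosB in H; rewrite (cosD (x *+ 2)); lra.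
Qed.

(** The functional equation is a doubling formula, which determines [C] up to
    sign on the dyadic parts of [pi / 2].  The sign is positive before
    [pi / 4]: a zero of [C] there would give a value 1 strictly between 0 and
    [pi].  The equation then propagates the equality to dyadic multiples, which
    are dense. *)
Lemma dAlembert_cos a : 0 <= a -> C a = cos (a *+ 2).
Proof.
move=> a0; have pi0 := @pi_gt0 R.
pose D y := C y - cos (y *+ 2).
have Dc : continuous D.
  move=> y; apply: cvgB; first exact: C_cont.
  apply: (@continuous_comp _ _ _ (fun y => y *+ 2)).
    have -> : (fun y : R => y *+ 2) = (fun y => y + y).
      by apply/funext => z; rewrite mulr2n.
    by apply: cvgD; exact: cvg_id.
  exact: continuous_cos.
apply/eqP; rewrite -subr_eq0 -/(D a); apply: contrapT => /negP Da.
have /Dc/nbhs_ballP[e /= e0 eD] : nbhs (D a) [set z | z != 0].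
  by apply: open_nbhs_nbhs; split => //; exact: open_neq.
have [k ke] : exists k, pi / 2 / 2 ^+ k < e.
  pose k := (Num.truncn (pi / 2 / e)).+1; exists k.
  have kk : pi / 2 / e < k%:R by apply: truncnS_gt.
  have k2 : k%:R <= 2 ^+ k :> R by rewrite -natrX ler_nat ltnW // ltn_expl.
  rewrite ltr_pdivrMr ?exprn_gt0 // -ltr_pdivrMl // mulrC.
  exact: lt_le_trans k2.
set x := pi / 2 / 2 ^+ k in ke.
have x0 : 0 < x by rewrite divr_gt0 ?exprn_gt0 // divr_gt0.
have ax0 : 0 <= a / x by rewrite divr_ge0 // ltW.
have := truncn_itv ax0; set m := Num.truncn _ => /andP[m1 m2].
move: m1 m2; rewrite ler_pdivlMr // ltr_pdivrMr // => m1 m2.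
suff : D (x *+ m) != 0 by rewrite /D C_mul ?subrr ?eqxx // C_dyadic.
apply: (eD (x *+ m)); rewrite /ball /= -mulr_natl ger0_norm ?subr_ge0 //.
by apply: lt_trans ke; move: m2; rewrite -natr1 mulrDl mul1r; lra.
Qed.

End DAlembert.

(** * Complex numbers, small matrices and the group SU(2) *)

Section Complex.
Variable R : realType.
Local Notation C := R[i].
Implicit Types z w : C.

Definition nsq z : R := Re z ^+ 2 + Im z ^+ 2.

Lemma complex_ext z w : Re z = Re w -> Im z = Im w -> z = w.
Proof. by case: z w => a b [c d] /= -> ->. Qed.

Lemma ReM z w : Re (z * w) = Re z * Re w - Im z * Im w.
Proof. by case: z w => a b [c d]. Qed.
Lemma ImM z w : Im (z * w) = Re z * Im w + Im z * Re w.
Proof. by case: z w => a b [c d]. Qed.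
Lemma ReD z w : Re (z + w) = Re z + Re w. Proof. exact: raddfD. Qed.
Lemma ImD z w : Im (z + w) = Im z + Im w. Proof. exact: raddfD. Qed.
Lemma ReN z : Re (- z) = - Re z. Proof. exact: raddfN. Qed.
Lemma ImN z : Im (- z) = - Im z. Proof. exact: raddfN. Qed.
Lemma ReJ z : Re z^*%C = Re z. Proof. by case: z. Qed.
Lemma ImJ z : Im z^*%C = - Im z. Proof. by case: z. Qed.
Lemma ReJn z : Re (Num.conj z) = Re z. Proof. exact: ReJ. Qed.
Lemma ImJn z : Im (Num.conj z) = - Im z. Proof. exact: ImJ. Qed.

Lemma Re0 : Re (0 : C) = 0. Proof. by []. Qed.
Lemma Im0 : Im (0 : C) = 0. Proof. by []. Qed.
Lemma Re1 : Re (1 : C) = 1. Proof. by []. Qed.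
Lemma Im1 : Im (1 : C) = 0. Proof. by []. Qed.

Definition cE := (ReM, ImM, ReD, ImD, ReN, ImN, ReJ, ImJ, ReJn, ImJn,
  Re0, Im0, Re1, Im1).

Lemma nsq_ge0 z : 0 <= nsq z.
Proof. by rewrite addr_ge0 ?sqr_ge0. Qed.

Lemma nsq_eq0 z : (nsq z == 0) = (z == 0).
Proof.
rewrite paddr_eq0 ?sqr_ge0 // !sqrf_eq0; apply/andP/eqP => [[/eqP a /eqP b]|->].
  exact: complex_ext.
by rewrite Re0 Im0 eqxx.
Qed.

Lemma nsqM z w : nsq (z * w) = nsq z * nsq w.
Proof. by rewrite /nsq !cE; ring. Qed.

Lemma nsqJ z : nsq z^*%C = nsq z.
Proof. by rewrite /nsq !cE sqrrN. Qed.

Lemma nsq_real (x : R) : nsq x%:C = x ^+ 2.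
Proof. by rewrite /nsq /= expr0n addr0. Qed.

Lemma nsq0 : nsq 0 = 0.
Proof. by apply/eqP; rewrite nsq_eq0. Qed.

Lemma mulCJ z : z * z^*%C = (nsq z)%:C.
Proof. by apply: complex_ext; rewrite !cE /=; [rewrite /nsq; ring | ring]. Qed.

Lemma unit_sqrt z : nsq z = 1 -> exists2 w, nsq w = 1 & w * w = z.
Proof.
move=> z1; exists (sqrtc z); last by rewrite -expr2 sqr_sqrtc.
have : nsq (sqrtc z) ^+ 2 = 1 by rewrite expr2 -nsqM -expr2 sqr_sqrtc.
move/eqP; rewrite sqrf_eq1 => /predU1P[//|/eqP H].
by have := nsq_ge0 (sqrtc z); rewrite H; lra.
Qed.

Lemma unit_phase z : exists2 w, nsq w = 1 & z * w = (Num.sqrt (nsq z))%:C.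
Proof.
have [->|z0] := eqVneq z 0.
  by exists 1; rewrite ?mul0r ?nsq0 ?sqrtr0 // /nsq /= expr0n expr1n addr0.
have nz : 0 < nsq z by rewrite lt_neqAle nsq_ge0 eq_sym nsq_eq0 z0.
have sz : Num.sqrt (nsq z) != 0 by rewrite sqrtr_eq0 -ltNge.
exists ((Num.sqrt (nsq z))^-1%:C * z^*%C).
  by rewrite nsqM nsqJ nsq_real exprVn sqr_sqrtr ?ltW // mulVf // gt_eqF.
rewrite mulrCA mulCJ -rmorphM /= -{2}(sqr_sqrtr (ltW nz)) expr2.
by rewrite mulrA mulVf // mul1r.
Qed.
Lemma nsq_continuous : continuous nsq.
Proof.
have sq (f : C -> R) : continuous f -> continuous (fun z : C => f z ^+ 2).
  move=> fc z; apply: (@continuous_comp _ _ _ f (fun t => t ^+ 2)); first exact: fc.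
  exact: exprn_continuous.
move=> z; exact: (cvgD (sq _ (@Re_continuous R) z) (sq _ (@Im_continuous R) z)).
Qed.

End Complex.

Section Matrices.

Lemma ord2P (i : 'I_2) : i = 0 \/ i = 1.
Proof. by case: i => [[|[|]]] // H; [left|right]; apply: val_inj. Qed.

Lemma ord3P (i : 'I_3) : [\/ i = 0, i = 1 | i = 2%:R].
Proof.
by case: i => [[|[|[|]]]] // H;
  [apply: Or31|apply: Or32|apply: Or33]; apply: val_inj.
Qed.

Lemma sum2 (V : nmodType) (f : 'I_2 -> V) : \sum_i f i = f 0 + f 1.
Proof. by rewrite !big_ord_recl big_ord0 addr0; congr (_ + f _); apply: val_inj. Qed.

Lemma sum3 (V : nmodType) (f : 'I_3 -> V) : \sum_i f i = f 0 + f 1 + f 2%:R.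
Proof.
rewrite !big_ord_recl big_ord0 addr0 addrA.
by congr (_ + f _ + f _); apply: val_inj.
Qed.

Lemma sum4 (V : nmodType) (f : 'I_4 -> V) :
  \sum_i f i = f 0 + f 1 + f 2%:R + f 3%:R.
Proof.
rewrite !big_ord_recl big_ord0 addr0 !addrA.
by congr (_ + f _ + f _ + f _); apply: val_inj.
Qed.

Lemma det2 (S : comNzRingType) (A : 'M[S]_2) :
  \det A = A 0 0 * A 1 1 - A 0 1 * A 1 0.
Proof.
rewrite (expand_det_row _ 0) sum2 /cofactor !det_mx11 !mxE /=.
rewrite expr0 mul1r /= expr1 mulN1r mulrN.
by congr (_ * A _ _ - _ * A _ _); apply: val_inj.
Qed.

Lemma det3_block (S : comNzRingType) (A : 'M[S]_3) :
  A 0 1 = 0 -> A 0 2%:R = 0 -> A 0 0 = 1 ->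
  \det A = A 1 1 * A 2%:R 2%:R - A 1 2%:R * A 2%:R 1.
Proof.
move=> A1 A2 A0; rewrite (expand_det_row _ 0) sum3 A0 A1 A2 !mul0r !addr0 mul1r.
rewrite /cofactor expr0 mul1r det2 !mxE.
by congr (A _ _ * A _ _ - A _ _ * A _ _); apply: val_inj.
Qed.

End Matrices.

Section SpecialUnitary.
Variable R : realType.
Local Notation C := R[i].
Implicit Types F G : SU2 R.

Lemma su2_unitary_entry F i j :
  \sum_k su2_mx F i k * (su2_mx F j k)^*%C = (i == j)%:R.
Proof.
have [/unitarymxP/matrixP/(_ i j) + _] := su2P F.
by rewrite !mxE => <-; apply: eq_bigr => k _; rewrite !mxE.
Qed.

Lemma su2_11 F : su2_mx F 1 1 = (su2_mx F 0 0)^*%C.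
Proof.
have [_] := su2P F; rewrite det2.
have := su2_unitary_entry F 0 0; have := su2_unitary_entry F 1 0.
rewrite !sum2 /= mulr0n mulr1n.
set a := su2_mx F 0 0; set b := su2_mx F 0 1.
set c := su2_mx F 1 0; set d := su2_mx F 1 1.
move=> h1 h2 h3.
(* a ring identity whose right-hand side the relations reduce to [conj a] *)
have : d = a^*%C * (a * d - b * c) + b * (c * a^*%C + d * b^*%C) +
    d * (1 - (a * a^*%C + b * b^*%C)) by ring.
by rewrite h1 h2 h3 subrr !mulr0 !addr0 mulr1.
Qed.

Lemma su2_01 F : su2_mx F 0 1 = - (su2_mx F 1 0)^*%C.
Proof.
have [_] := su2P F; rewrite det2.
have := su2_unitary_entry F 1 1; have := su2_unitary_entry F 0 1.
rewrite !sum2 /= mulr0n mulr1n.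
set a := su2_mx F 0 0; set b := su2_mx F 0 1.
set c := su2_mx F 1 0; set d := su2_mx F 1 1.
move=> h1 h2 h3.
have : b = - c^*%C * (a * d - b * c) + d * (a * c^*%C + b * d^*%C) +
    b * (1 - (c * c^*%C + d * d^*%C)) by ring.
by rewrite h1 h2 h3 subrr !mulr0 !addr0 mulr1.
Qed.

Lemma su2_unit F : nsq (su2_mx F 0 0) + nsq (su2_mx F 1 0) = 1.
Proof.
have [_] := su2P F; rewrite det2 su2_11 su2_01 => /(congr1 (@complex.Re R)).
by rewrite !cE /nsq => H; lra.
Qed.

Lemma su2_eq F G : su2_mx F 0 0 = su2_mx G 0 0 ->
  su2_mx F 1 0 = su2_mx G 1 0 -> F = G.
Proof.
move=> e0 e1; apply: su2_mx_inj; apply/matrixP => i j.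
by have [->|->] := ord2P i; have [->|->] := ord2P j; rewrite ?su2_11 ?su2_01 ?e0 ?e1.
Qed.

(** The matrix of a quaternion with coordinates p and q; for unit quaternions these are
    the elements of SU(2), with first column [(p, q)]. *)
Definition quat (p q : C) : 'M[C]_2 :=
  \matrix_(i, j) (if j == 0 then (if i == 0 then p else q)
                  else (if i == 0 then - q^*%C else p^*%C)).

Lemma quat_su2 p q : nsq p + nsq q = 1 -> SU2_set (quat p q).
Proof.
move=> pq; split; last first.
  rewrite det2 !mxE /=; apply: complex_ext; rewrite !cE -?pq /nsq; ring.
apply/unitarymxP/matrixP => i j; rewrite !mxE sum2 !mxE.
by have [->|->] := ord2P i; have [->|->] := ord2P j; rewrite /=;
  apply: complex_ext; rewrite !cE -?pq /nsq; ring.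
Qed.

Definition su2_of p q (pq : nsq p + nsq q = 1) : SU2 R := mk_su2 (quat_su2 pq).

Lemma su2_of00 p q pq : su2_mx (@su2_of p q pq) 0 0 = p.
Proof. by rewrite /su2_mx /= mxE. Qed.
Lemma su2_of10 p q pq : su2_mx (@su2_of p q pq) 1 0 = q.
Proof. by rewrite /su2_mx /= mxE. Qed.

Lemma su2M00 F G : su2_mx (F * G)%g 0 0 =
  su2_mx F 0 0 * su2_mx G 0 0 - (su2_mx F 1 0)^*%C * su2_mx G 1 0.
Proof. by rewrite su2_mxM mxE sum2 su2_01 mulNr. Qed.
Lemma su2M10 F G : su2_mx (F * G)%g 1 0 =
  su2_mx F 1 0 * su2_mx G 0 0 + (su2_mx F 0 0)^*%C * su2_mx G 1 0.
Proof. by rewrite su2_mxM mxE sum2 su2_11. Qed.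

Lemma su2V00 F : su2_mx F^-1%g 0 0 = (su2_mx F 0 0)^*%C.
Proof. by rewrite [LHS]mxE mxE. Qed.
Lemma su2V10 F : su2_mx F^-1%g 1 0 = - su2_mx F 1 0.
Proof. by rewrite [LHS]mxE mxE su2_01 rmorphN /=; congr (- _); exact: conjcK. Qed.

Lemma su2_100 : su2_mx (1%g : SU2 R) 0 0 = 1. Proof. by rewrite [LHS]mxE. Qed.
Lemma su2_110 : su2_mx (1%g : SU2 R) 1 0 = 0. Proof. by rewrite [LHS]mxE. Qed.

Lemma torus_iff F : torus R F <-> su2_mx F 1 0 = 0.
Proof.
split=> [/is_diag_mxP -> //|h]; apply/is_diag_mxP => i j.
by have [->|->] := ord2P i; have [->|->] := ord2P j;
  rewrite ?eqxx // su2_01 h conjc0 oppr0.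
Qed.

End SpecialUnitary.

(** * The zonal function of a double covering *)

Section Cover.
Variables (R : realType) (cov : spin_cover R).
Local Notation C := R[i].
Implicit Types F G : SU2 R.

Lemma cov1 : cov 1%g = 1%g.
Proof. by apply: so3_mx_inj; rewrite -[LHS]/(rot cov 1%g) rot1. Qed.

Lemma covV F : cov F^-1%g = (cov F)^-1%g.
Proof.
by apply: (mulgI (cov F)); rewrite -spin_morph !mulgV cov1.
Qed.

Lemma neg1_unit : nsq (-1 : C) + nsq 0 = 1.
Proof. by rewrite nsq0 /nsq !cE; ring. Qed.

Definition su2_neg1 : SU2 R := su2_of neg1_unit.

Lemma su2_involution F : (F * F = 1)%g -> F = 1%g \/ F = su2_neg1.
Proof.
move=> FF; have FV : (F^-1 = F)%g by apply: (mulgI F); rewrite mulgV FF.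
have p : su2_mx F 0 0 = (su2_mx F 0 0)^*%C by rewrite -su2V00 FV.
have q : su2_mx F 1 0 = - su2_mx F 1 0 by rewrite -su2V10 FV.
have {q}q : su2_mx F 1 0 = 0.
  have := congr1 (@complex.Re R) q; have := congr1 (@complex.Im R) q.
  by rewrite !cE => *; apply: complex_ext; rewrite !cE; lra.
have pI : Im (su2_mx F 0 0) = 0.
  by move/(congr1 (@complex.Im R)): p; rewrite cE => *; lra.
have := su2_unit F; rewrite q nsq0 addr0 /nsq pI expr0n addr0 => /eqP.
rewrite sqrf_eq1 => /orP[/eqP pR|/eqP pR]; [left|right]; apply: su2_eq.
- by rewrite su2_100; apply: complex_ext; rewrite ?pR ?pI.
- by rewrite su2_110.
- by rewrite su2_of00; apply: complex_ext; rewrite ?pR ?pI !cE ?oppr0.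
- by rewrite su2_of10.
Qed.

(** The kernel has two elements because the covering has two sheets, so its
    nontrivial element is an involution, and SU(2) has only one. *)
Lemma cov_kernel F : cov F = 1%g <-> F = 1%g \/ F = su2_neg1.
Proof.
have [x1 [x2 [x12 c1 c2 cK]]] :=
  double_covering_fibre (1%g : SO3 R) (spin_double_covering cov).
have [k [k1 ck kK]] : exists k, [/\ k <> 1%g, cov k = 1%g &
    forall F, cov F = 1%g -> F = 1%g \/ F = k].
  have [e1|e2] := cK _ cov1.
    exists x2; split => //; last by move=> G /cK; rewrite -e1.
    by rewrite e1; exact: nesym.
  exists x1; split => //; first by rewrite e2.
  by move=> G /cK; rewrite -e2 => -[]; [right|left].
have kk : (k * k = 1)%g.
  have : cov (k * k)%g = 1%g by rewrite spin_morph ck mulg1.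
  by case/kK => // /(canRL (mulgK k)); rewrite mulgV.
have [//|kE] := su2_involution kk.
split=> [/kK|[]->]; rewrite ?cov1 ?kE //.
by rewrite -kE.
Qed.

(** The matrix coefficient of the rotation at the fixed vector of the torus:
    it is the spherical function that governs all scalar products of framed
    vectors. *)
Definition zonal F : R := rot cov F 0 0.

Lemma rot_orth F : (rot cov F)^T *m rot cov F = 1%:M.
Proof. by apply: mulmx1C; have [] := so3P (cov F). Qed.

Lemma rotV F : rot cov F^-1%g = (rot cov F)^T.
Proof. by rewrite /rot covV. Qed.

Lemma rot_eps1E F i : (rot cov F *m eps1 R) i 0 = rot cov F i 0.
Proof. by rewrite mxE sum3 !mxE /= mulr1 !mulr0 !addr0. Qed.

Lemma torus_rotE F : torus R F <-> rot cov F *m eps1 R = eps1 R.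
Proof.
have E := spin_torus cov; split=> [tF|sF].
  have : (cov @` torus R) (cov F) by exists F.
  by rewrite E.
have : [set A | so3_mx A *m eps1 R = eps1 R] (cov F) by [].
rewrite -E => -[t tt tF].
have /cov_kernel : cov (t^-1 * F)%g = 1%g by rewrite spin_morph covV tF mulVg.
move=> H; have -> : F = (t * (t^-1 * F))%g by rewrite mulgA mulgV mul1g.
apply: torusM => //; case: H => ->; first exact: torus1.
by apply/torus_iff; rewrite su2_of10.
Qed.

Lemma zonal_torusr F t : torus R t -> zonal (F * t)%g = zonal F.
Proof.
by move=> /torus_rotE tt; rewrite /zonal -rot_eps1E rotM -mulmxA tt rot_eps1E.
Qed.

Lemma zonalV F : zonal F^-1%g = zonal F.
Proof. by rewrite /zonal rotV mxE. Qed.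

Lemma zonal_torusl F t : torus R t -> zonal (t * F)%g = zonal F.
Proof.
move=> tt; rewrite -zonalV invgM zonal_torusr ?zonalV //; exact: torusV.
Qed.

Lemma rot_col_norm F :
  rot cov F 0 0 ^+ 2 + rot cov F 1 0 ^+ 2 + rot cov F 2%:R 0 ^+ 2 = 1.
Proof. by have /matrixP/(_ 0 0) := rot_orth F; rewrite !mxE sum3 !mxE !expr2. Qed.

(** A rotation matrix with corner entry 1 fixes [eps1], so it comes from the
    torus by the hypothesis on the covering. *)
Lemma zonal_eq1 F : zonal F = 1 -> torus R F.
Proof.
move=> z1; apply/torus_rotE; apply/matrixP => i j; rewrite ord1 rot_eps1E.
have := rot_col_norm F; rewrite -/(zonal F) z1 => H.
have h1 : rot cov F 1 0 = 0.
  apply/eqP; rewrite -sqrf_eq0; apply/eqP.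
  by have := sqr_ge0 (rot cov F 1 0); have := sqr_ge0 (rot cov F 2%:R 0); lra.
have h2 : rot cov F 2%:R 0 = 0.
  apply/eqP; rewrite -sqrf_eq0; apply/eqP.
  by have := sqr_ge0 (rot cov F 1 0); have := sqr_ge0 (rot cov F 2%:R 0); lra.
by rewrite mxE; have [->|->|->] := ord3P i; rewrite ?h1 ?h2 //=; exact: z1.
Qed.

Lemma half_turn_unit : nsq ('i%C : C) + nsq 0 = 1.
Proof. by rewrite nsq0 /nsq /=; ring. Qed.

(** Its square is -1, which lies in the kernel, so that its rotation is an
    involution fixing [eps1]. *)
Definition half_turn : SU2 R := su2_of half_turn_unit.

Lemma half_turn_torus : torus R half_turn.
Proof. by apply/torus_iff; rewrite su2_of10. Qed.

Lemma half_turn_sqr : (half_turn * half_turn)%g = su2_neg1.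
Proof.
apply: su2_eq; rewrite ?su2M00 ?su2M10 !su2_of00 !su2_of10;
  by apply: complex_ext; rewrite !cE /=; ring.
Qed.

(** The rotation is an involution other than the identity, since [half_turn]
    is not in the kernel; in SO(3) an involution that fixes [eps1] is
    [diag(1, -1, -1)]. *)
Lemma rot_half_turn : 1%:M + rot cov half_turn = 2 *: delta_mx 0 0.
Proof.
set A := rot cov half_turn.
have Ae : A *m eps1 R = eps1 R by apply/torus_rotE/half_turn_torus.
have AA : A *m A = 1%:M.
  rewrite -rotM half_turn_sqr /rot.
  by have /cov_kernel -> : su2_neg1 = 1%g \/ su2_neg1 = su2_neg1 by right.
have AT : A^T = A.
  by rewrite -[LHS]mulmx1 -AA mulmxA rot_orth mul1mx.
have A1 : A != 1%:M.
  apply/eqP => A1; have /cov_kernel[] : cov half_turn = 1%g by apply: so3_mx_inj.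
    move=> /(congr1 (fun F => su2_mx F 0 0)); rewrite su2_of00 su2_100.
    by move=> /(congr1 (@complex.Re R)) /= /esym/eqP; rewrite oner_eq0.
  move=> /(congr1 (fun F => su2_mx F 0 0)); rewrite !su2_of00.
  by move=> /(congr1 (@complex.Im R)) /= /eqP; rewrite oppr0 oner_eq0.
have AS i j : A i j = A j i by rewrite -[in LHS]AT mxE.
have A0 i : A i 0 = (i == 0)%:R.
  by rewrite -rot_eps1E -/A Ae mxE eqxx andbT.
have dA : \det A = 1 by have [] := so3P (cov half_turn).
have := dA; rewrite det3_block ?(AS 0 1) ?(AS 0 2%:R) ?A0 // (AS 2%:R 1).
have := congr1 (fun M : 'M[R]_3 => M 1 1) AA.
have := congr1 (fun M : 'M[R]_3 => M 1 2%:R) AA.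
have := congr1 (fun M : 'M[R]_3 => M 2%:R 2%:R) AA.
rewrite !mxE !sum3 !(AS 0 1) !(AS 0 2%:R) !A0 !(AS 2%:R 1) /=.
set a := A 1 1; set b := A 1 2%:R; set d := A 2%:R 2%:R.
rewrite !mulr0n !mulr1n !mulr0 !add0r => h1 h2 h3 h4.
have bad : b = 0.
  apply/eqP; apply: contraT => b0; have : a + d = 0.
    by apply: (mulfI b0); rewrite mulr0 -h2; ring.
  move=> H; move: h4; rewrite (_ : d = - a); last by lra.
  by have := sqr_ge0 a; have := sqr_ge0 b; rewrite !expr2; nra.
rewrite bad in h1 h2 h3 h4.
have ad : a = d.
  have : d * (a * d) = d by rewrite (_ : a * d = 1) ?mulr1 //; lra.
  by rewrite mulrCA (_ : d * d = 1) ?mulr1 //; lra.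
have am1 : a = -1.
  have /eqP : (a - 1) * (a + 1) = 0 by rewrite -ad in h1 h4; lra.
  rewrite mulf_eq0 => /orP[|] /eqP H; last by lra.
  rewrite /b in bad; exfalso; move: A1 => /eqP; apply.
  apply/matrixP => i j; rewrite mxE.
  have a1 : A 1 1 = 1 by rewrite -/a; lra.
  have d1 : A 2%:R 2%:R = 1 by rewrite -/d -ad.
  by have [->|->|->] := ord3P i; have [->|->|->] := ord3P j;
    rewrite ?A0 ?(AS 0 1) ?(AS 0 2%:R) ?A0 ?(AS 2%:R 1) ?a1 ?d1 ?bad.
have dm1 : A 2%:R 2%:R = -1 by rewrite -/d -ad.
rewrite /a in am1; rewrite /b in bad.
apply/matrixP => i j; rewrite !mxE.
by have [->|->|->] := ord3P i; have [->|->|->] := ord3P j;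
    rewrite ?A0 ?(AS 0 1) ?(AS 0 2%:R) ?A0 ?(AS 2%:R 1) ?am1 ?dm1 ?bad /=; ring.
Qed.

(** Half of [1 + rot half_turn] is the orthogonal projection onto [eps1], so
    the mean over the half-turn factors through the two corner entries.  This
    finite average replaces the integral over the torus in the usual product
    formula of spherical functions. *)
Lemma zonal_mean F G :
  zonal (F * G)%g + zonal (F * half_turn * G)%g = 2 * zonal F * zonal G.
Proof.
have : rot cov F *m (1%:M + rot cov half_turn) *m rot cov G =
       2 *: (rot cov F *m delta_mx 0 0 *m rot cov G).
  by rewrite rot_half_turn -scalemxAr -scalemxAl.
rewrite mulmxDr mulmx1 mulmxDl -!rotM => /matrixP/(_ 0 0).
rewrite mxE [RHS]mxE -/(zonal _) -/(zonal _) => ->; rewrite -mulrA; congr (_ * _).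
by rewrite mxE sum3 !mxE !sum3 !mxE /= !mulr0 !addr0 !mul0r !addr0 mulr1.
Qed.

End Cover.

Section Zonal.
Variables (R : realType) (cov : spin_cover R).
Local Notation C := R[i].
Implicit Types F G : SU2 R.
Local Notation zonal := (zonal cov).

Lemma planar_unit (a : R) : nsq (cos a)%:C + nsq (sin a)%:C = 1.
Proof. by rewrite !nsq_real cos2Dsin2. Qed.

Definition planar a : SU2 R := su2_of (planar_unit a).

Lemma planarD a b : planar (a + b) = (planar a * planar b)%g.
Proof.
by apply: su2_eq; rewrite ?su2M00 ?su2M10 !su2_of00 !su2_of10;
  apply: complex_ext; rewrite !cE /= ?cosD ?sinD; ring.
Qed.

Lemma planar_half_turn a :
  (planar a * half_turn R)%g = (half_turn R * planar (- a))%g.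
Proof.
by apply: su2_eq; rewrite ?su2M00 ?su2M10 !su2_of00 !su2_of10;
  apply: complex_ext; rewrite !cE /= ?cosN ?sinN; ring.
Qed.

Lemma su2_continuous (X : topologicalType) (f : X -> SU2 R) :
  (forall i j, continuous (fun x => su2_mx (f x) i j)) -> continuous f.
Proof.
move=> fc; apply: (@continuous_set_type X 'M[C]_2 (@SU2_set R) f).
exact: continuous_mx.
Qed.

Lemma su2_entry_continuous i j : continuous (fun F : SU2 R => su2_mx F i j).
Proof.
move=> F; apply: (@continuous_comp _ 'M[C]_2 _ (@su2_mx R) (fun M => M i j)).
  exact: (@set_val_continuous 'M[C]_2 (@SU2_set R)).
exact: continuous_entry.
Qed.

Lemma rot_entry_continuous i j : continuous (fun F : SU2 R => rot cov F i j).
Proof.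
move=> F; apply: (@continuous_comp _ (SO3 R) _ cov (fun A => so3_mx A i j)).
  by have [+ _] := spin_double_covering cov; apply.
apply: (@continuous_comp _ 'M[R]_3 _ (@so3_mx R) (fun M => M i j)).
  exact: (@set_val_continuous 'M[R]_3 (@SO3_set R)).
exact: continuous_entry.
Qed.

Lemma planar_continuous : continuous planar.
Proof.
have cc : continuous (fun a : R => (cos a)%:C : C).
  apply: realc_continuous; exact: continuous_cos.
have sc : continuous (fun a : R => (sin a)%:C : C).
  apply: realc_continuous; exact: continuous_sin.
apply: su2_continuous => i j.
have [->|->] := ord2P i; have [->|->] := ord2P j.
- under eq_fun do rewrite su2_of00.
  exact: cc.
- under eq_fun do rewrite su2_01 su2_of10.
  exact: cplx_continuousN (conjc_continuous sc).
- under eq_fun do rewrite su2_of10.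
  exact: sc.
- under eq_fun do rewrite su2_11 su2_of00.
  exact: conjc_continuous cc.
Qed.

Lemma zonal1 : zonal 1%g = 1.
Proof. by rewrite /zonal rot1 mxE. Qed.

(** Conjugation by the half-turn inverts planar rotations, which turns
    [zonal_mean] into d'Alembert's equation.  A value 1 at an angle strictly
    between 0 and [pi] would put a non-diagonal rotation in the torus. *)
Lemma zonal_planar a : 0 <= a -> zonal (planar a) = cos (a *+ 2).
Proof.
apply: (@dAlembert_cos R (fun a => zonal (planar a))).
- move=> x; apply: (@continuous_comp _ _ _ planar zonal).
    exact: planar_continuous.
  exact: rot_entry_continuous.
- move=> x y.
  have := zonal_mean cov (planar x) (planar y).
  rewrite planar_half_turn -mulgA (zonal_torusl _ _ (half_turn_torus R)).
  by rewrite -!planarD [- x + y]addrC.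
- rewrite (_ : planar 0 = 1%g) ?zonal1 //.
  by apply: su2_eq; rewrite ?su2_100 ?su2_110 ?su2_of00 ?su2_of10 ?cos0 ?sin0.
- have /(zonal_torusr cov 1%g) : torus R (planar pi).
    by apply/torus_iff; rewrite su2_of10 sinpi.
  by rewrite mul1g zonal1.
move=> x xpi; apply/eqP => /zonal_eq1/torus_iff; rewrite su2_of10.
by move=> /(congr1 (@complex.Re R)) /=; have := sin_gt0_pi xpi; lra.
Qed.

(** The phases of the first column [(p, q)] are removed by diagonal matrices on
    both sides.  If [P] and [Q] are the phases to be cancelled, the diagonal
    matrices of [x] and [y] must satisfy [x y = P] and [conj x * y = Q], hence
    [y^2 = P Q]. *)
Lemma cartan_decomposition F : exists s t a,
  [/\ torus R s, torus R t, 0 <= a, (s * F * t = planar a)%g &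
      cos a ^+ 2 = nsq (su2_mx F 0 0)].
Proof.
set p := su2_mx F 0 0; set q := su2_mx F 1 0.
have pq : nsq p + nsq q = 1 by exact: su2_unit.
have [P P1 pP] := unit_phase p; have [Q Q1 qQ] := unit_phase q.
have PQ1 : nsq (P * Q) = 1 by rewrite nsqM P1 Q1 mulr1.
have [y y1 yPQ] := unit_sqrt PQ1.
have x1 : nsq (P * y^*%C) = 1 by rewrite nsqM nsqJ P1 y1 mulr1.
have hx : nsq (P * y^*%C) + nsq 0 = 1 by rewrite x1 nsq0 addr0.
have hy : nsq y + nsq 0 = 1 by rewrite y1 nsq0 addr0.
have p0 := nsq_ge0 p; have q0 := nsq_ge0 q.
have sp : -1 <= Num.sqrt (nsq p) <= 1.
  have := sqrtr_ge0 (nsq p).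
  have : Num.sqrt (nsq p) <= Num.sqrt 1 by apply: ler_wsqrtr; lra.
  by rewrite sqrtr1 => h1 h2; rewrite h1 andbT; lra.
have ca : cos (acos (Num.sqrt (nsq p))) = Num.sqrt (nsq p).
  by rewrite acosK // in_itv.
have sa : sin (acos (Num.sqrt (nsq p))) = Num.sqrt (nsq q).
  by rewrite sin_acos // sqr_sqrtr //; congr Num.sqrt; lra.
exists (su2_of hx), (su2_of hy), (acos (Num.sqrt (nsq p))); split.
- by apply/torus_iff; rewrite su2_of10.
- by apply/torus_iff; rewrite su2_of10.
- exact: acos_ge0.
- have yy : y^*%C * y = 1 by rewrite mulrC mulCJ y1.
  have PP : P^*%C * P = 1 by rewrite mulrC mulCJ P1.
  apply: su2_eq; rewrite ?su2M00 ?su2M10 !su2_of00 !su2_of10 ?ca ?sa -/p -/q.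
    rewrite -pP; transitivity (p * P * (y^*%C * y)); first by rewrite conjc0; ring.
    by rewrite yy mulr1.
  rewrite -qQ mulr0 addr0 mul0r add0r rmorphM /= [conjc (conjc y)]conjcK.
  transitivity (q * P^*%C * (y * y)); first ring.
  by rewrite yPQ; transitivity (q * Q * (P^*%C * P)); [ring | rewrite PP mulr1].
- by rewrite ca sqr_sqrtr.
Qed.

Lemma zonalE F : zonal F = 2 * nsq (su2_mx F 0 0) - 1.
Proof.
have [s [t [a [ts tt a0 sFt ca]]]] := cartan_decomposition F.
rewrite -ca -(zonal_torusl cov F ts) -(zonal_torusr cov _ tt) sFt.
by rewrite zonal_planar // cos_mulr2n; ring.
Qed.

Lemma rot_eps1_dot F G :
  ((rot cov F *m eps1 R)^T *m (rot cov G *m eps1 R)) 0 0 =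
  2 * nsq ((su2_mx F 0 0)^*%C * su2_mx G 0 0 +
           (su2_mx F 1 0)^*%C * su2_mx G 1 0) - 1.
Proof.
transitivity (zonal (F^-1 * G)%g).
  rewrite trmx_mul -mulmxA [(rot cov F)^T *m _]mulmxA -rotV -rotM.
  by rewrite mxE sum3 !rot_eps1E !mxE /= !mul0r !addr0 mul1r.
by rewrite zonalE su2M00 su2V00 su2V10 rmorphN mulNr opprK.
Qed.

End Zonal.

(** * Imploded spin-framed vectors as spinors *)

Section Enorm.
Variable R : realType.
Implicit Types (e : 'cV[R]_3) (t : R).

Lemma enorm_sqr e : enorm e ^+ 2 = (e^T *m e) 0 0.
Proof.
rewrite sqr_sqrtr; last by apply: sumr_ge0 => i _; exact: sqr_ge0.
by rewrite mxE; apply: eq_bigr => i _; rewrite mxE expr2.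
Qed.

Lemma enorm_ge0 e : 0 <= enorm e. Proof. exact: sqrtr_ge0. Qed.

Lemma enorm_eq0 e : (enorm e == 0) = (e == 0).
Proof.
rewrite sqrtr_eq0 le_eqVlt ltNge sumr_ge0 ?orbF; last by move=> i _; exact: sqr_ge0.
rewrite psumr_eq0; last by move=> i _; exact: sqr_ge0.
apply/allP/eqP => [h|-> i _]; last by rewrite /= mxE expr0n.
apply/matrixP => i j; rewrite ord1 mxE.
by have := h i; rewrite mem_index_enum /= sqrf_eq0 => /(_ isT)/eqP.
Qed.

Lemma enormZ t e : 0 <= t -> enorm (t *: e) = t * enorm e.
Proof.
move=> t0; apply/eqP; rewrite -(@eqrXn2 _ 2) ?mulr_ge0 ?enorm_ge0 //.
by rewrite exprMn !enorm_sqr [(t *: e)^T]linearZ /= -scalemxAl -scalemxAr scalerA mxE -expr2.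
Qed.

Lemma enorm_eps1 : enorm (eps1 R) = 1.
Proof. by rewrite /enorm sum3 !mxE /= expr1n expr0n !addr0 sqrtr1. Qed.

Lemma enorm_continuous : continuous (@enorm R).
Proof.
move=> e; apply: (@continuous_comp _ _ _ (fun e : 'cV[R]_3 => \sum_i e i 0 ^+ 2));
  last exact: sqrt_continuous.
have -> : (fun e : 'cV[R]_3 => \sum_i e i 0 ^+ 2) =
    (fun e => e 0 0 ^+ 2 + e 1 0 ^+ 2 + e 2%:R 0 ^+ 2) by apply/funext => x; exact: sum3.
have c i : {for e, continuous (fun e : 'cV[R]_3 => e i 0 ^+ 2)}.
  by apply: (@continuous_comp _ _ _ (fun e : 'cV[R]_3 => e i 0) (fun t => t ^+ 2));
    [exact: continuous_entry | exact: exprn_continuous].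
exact: (cvgD (cvgD (c _) (c _)) (c _)).
Qed.

End Enorm.

Section SU2Compact.
Variable R : realType.
Local Notation C := R[i].

(** SU(2) is compact as the image of the unit sphere of the quaternions. *)
Definition sphere3 : set 'rV[R]_4 :=
  [set x | \sum_i x 0 i ^+ 2 = 1].

Lemma sphere3_compact : compact sphere3.
Proof.
have cI : compact [set x : 'rV[R]_4 | forall i, `[-1, 1]%classic (x ord0 i)].
  by apply: (@rV_compact R 4 (fun=> `[-1, 1]%classic)) => i; exact: segment_compact.
apply: (@subclosed_compact _ _ _ _ cI).
  rewrite (_ : sphere3 = (fun x : 'rV[R]_4 =>
    x 0 0 ^+ 2 + x 0 1 ^+ 2 + x 0 2%:R ^+ 2 + x 0 3%:R ^+ 2) @^-1` [set 1]); last first.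
    by apply/seteqP; split => x; rewrite /sphere3 /= sum4.
  apply: closed_comp; last exact: closed_eq.
  move=> x _; have c i : (fun x : 'rV[R]_4 => x 0 i ^+ 2) x @[x --> x] --> x 0 i ^+ 2.
    by apply: (@continuous_comp _ _ _ (fun x : 'rV[R]_4 => x 0 i) (fun t => t ^+ 2));
    [exact: continuous_entry | exact: exprn_continuous].
  exact: (cvgD (cvgD (cvgD (c _) (c _)) (c _)) (c _)).
move=> x /= x1 i; rewrite in_itv /=.
have : x 0 i ^+ 2 <= 1.
  by rewrite -x1 (bigD1 i) //= lerDl sumr_ge0 // => j _; exact: sqr_ge0.
by move=> h; apply/andP; split; nra.
Qed.

Definition quat4 (x : 'rV[R]_4) : 'M[C]_2 :=
  quat (x 0 0 +i* x 0 1) (x 0 2%:R +i* x 0 3%:R).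

Lemma quat4_continuous : continuous quat4.
Proof.
have ec (i : 'I_4) : continuous (fun x : 'rV[R]_4 => x 0 i) by exact: continuous_entry.
have pc : continuous (fun x : 'rV[R]_4 => x 0 0 +i* x 0 1 : C).
  exact: complex_continuous.
have qc : continuous (fun x : 'rV[R]_4 => x 0 2%:R +i* x 0 3%:R : C).
  exact: complex_continuous.
apply: continuous_mx => i j; under eq_fun do rewrite mxE.
have [->|->] := ord2P i; have [->|->] := ord2P j.
- exact: pc.
- exact: cplx_continuousN (conjc_continuous qc).
- exact: qc.
- exact: conjc_continuous pc.
Qed.

Lemma su2_compact : compact [set: SU2 R].
Proof.
apply: (@compact_set_type 'M[C]_2 (@SU2_set R)).
rewrite (_ : _ @` _ = quat4 @` sphere3).
  apply: continuous_compact; last exact: sphere3_compact.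
  exact: continuous_subspaceT quat4_continuous.
apply/seteqP; split => [_ [F _ <-]|_ [x x1 <-]].
  pose p := su2_mx (F : SU2 R) 0 0; pose q := su2_mx (F : SU2 R) 1 0.
  exists (\row_i [:: Re p; Im p; Re q; Im q]`_i).
    rewrite /sphere3 /= sum4 !mxE /=.
    by have := su2_unit (F : SU2 R); rewrite -/p -/q /nsq => <-; ring.
  rewrite /quat4 !mxE /=.
  apply/matrixP => i j; rewrite mxE; have pE : Re p +i* Im p = p by case: (p).
  have qE : Re q +i* Im q = q by case: (q).
  rewrite pE qE; have [->|->] := ord2P i; have [->|->] := ord2P j;
    by rewrite /= -[set_val F]/(su2_mx F) ?su2_01 ?su2_11.
have h : nsq (x 0 0 +i* x 0 1) + nsq (x 0 2%:R +i* x 0 3%:R) = 1.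
  by move: x1; rewrite /sphere3 /= sum4 /nsq /= => <-; ring.
by exists (su2_of h).
Qed.

End SU2Compact.

Section Spinor.
Variables (R : realType) (cov : spin_cover R).
Local Notation C := R[i].
Implicit Types (F : SU2 R) (x : spin_framed cov) (z : imploded cov) (i : 'I_2).

Lemma vecE x : vec x = enorm (vec x) *: (rot cov (frame x) *m eps1 R).
Proof.
have [t t0 ->] := spin_framedP x.
by rewrite enormZ // enorm_so3 enorm_eps1 mulr1.
Qed.

(** The scaling by the square root makes the squared norm of the spinor equal
    to the length of the vector, see [spinor_norm]; at length zero the frame
    is forgotten, as in the implosion. *)
Definition framed_spinor i x : C :=
  (Num.sqrt (enorm (vec x)))%:C * su2_mx (frame x) i 0.

Definition spinor i z : C := framed_spinor i (repr z).

Lemma spinor_pi i x : spinor i (\pi_(imploded cov) x) = framed_spinor i x.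
Proof.
rewrite /spinor.
have /imploded_eqP/predU1P[->//|/andP[/eqP x0 /eqP y0]] :=
  reprK (\pi_(imploded cov) x).
have e0 : enorm (0 : 'cV[R]_3) = 0 by apply/eqP; rewrite enorm_eq0.
by rewrite /framed_spinor x0 y0 e0 sqrtr0 !mul0r.
Qed.

Lemma spinor_norm z : nsq (spinor 0 z) + nsq (spinor 1 z) = enorm (edge z).
Proof.
elim/quotW: z => x; rewrite !spinor_pi edge_pi !nsqM !nsq_real.
by rewrite -mulrDr su2_unit mulr1 sqr_sqrtr ?enorm_ge0.
Qed.

Lemma spinor_inj z z' : spinor 0 z = spinor 0 z' -> spinor 1 z = spinor 1 z' -> z = z'.
Proof.
elim/quotW: z => x; elim/quotW: z' => y h0 h1.
have := spinor_norm (\pi x); rewrite h0 h1 spinor_norm !edge_pi => exy.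
move: h0 h1; rewrite !spinor_pi /framed_spinor exy => h0 h1.
apply/imploded_eqP; have [y0|yn0] := eqVneq (vec x) 0.
  apply/orP; right; rewrite y0 eqxx /= -enorm_eq0 exy enorm_eq0 y0; exact: eqxx.
have sn0 : (Num.sqrt (enorm (vec x)))%:C != 0 :> C.
  rewrite (inj_eq (@complexI R)) sqrtr_eq0 -ltNge lt_neqAle enorm_ge0.
  by rewrite eq_sym enorm_eq0 yn0.
apply/orP; left; apply/eqP.
have fE : frame x = frame y by apply: su2_eq; exact: (mulfI sn0).
by apply: spin_framed_inj; rewrite // vecE [RHS]vecE fE exy.
Qed.

(** The length [t] is truncated at 0 so that [framed] is a total continuous
    function on the product of SU(2) and the real line. *)
Lemma framed_subproof F (t : R) :
  spin_framed cov (F, Num.max 0 t *: (rot cov F *m eps1 R)).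
Proof. by exists (Num.max 0 t) => //=; rewrite le_max lexx. Qed.

Definition framed F t : spin_framed cov := set_elt (framed_subproof F t).

Lemma enorm_framed F t : 0 <= t -> enorm (vec (framed F t)) = t.
Proof.
move=> t0; rewrite [vec _]/= enormZ ?le_max ?lexx // enorm_so3 enorm_eps1 mulr1.
exact: max_r.
Qed.

Lemma framedK x : framed (frame x) (enorm (vec x)) = x.
Proof.
apply: spin_framed_inj => //; rewrite [RHS]vecE.
rewrite -[LHS]/(Num.max 0 (enorm (vec x)) *: (rot cov (frame x) *m eps1 R)).
by rewrite max_r // enorm_ge0.
Qed.

Lemma framed_continuous : continuous (fun Ft : SU2 R * R => framed Ft.1 Ft.2).
Proof.
suff : continuous (fun Ft : SU2 R * R => Num.max 0 Ft.2 *: (rot cov Ft.1 *m eps1 R)).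
  move=> sc.
  apply: (@continuous_set_type _ (SU2 R * 'cV[R]_3)%type (spin_framed cov)).
  apply: (continuous_pair _ sc) => Ft; exact: cvg_fst.
apply: continuous_mx => i j; rewrite ord1.
under eq_fun do rewrite mxE rot_eps1E.
move=> {}Ft; apply: (@cvgM R _ _ _ (fun Ft : SU2 R * R => Num.max 0 Ft.2)
  (fun Ft => rot cov Ft.1 i 0)).
  apply: (@continuous_comp _ R _ snd (fun t => Num.max 0 t)); first exact: cvg_snd.
  by apply: continuous_max; [exact: cvg_cst | exact: cvg_id].
apply: (@continuous_comp _ (SU2 R) _ fst (fun F => rot cov F i 0)).
  exact: cvg_fst.
exact: rot_entry_continuous.
Qed.

Lemma spinor_surj p q : exists2 z, spinor 0 z = p & spinor 1 z = q.
Proof.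
pose t := nsq p + nsq q; have t0 : 0 <= t by rewrite addr_ge0 ?nsq_ge0.
have [tz|tn] := eqVneq t 0.
  have /andP[p0 q0] : (nsq p == 0) && (nsq q == 0).
    by rewrite -paddr_eq0 ?nsq_ge0 //; apply/eqP.
  move: p0 q0; rewrite !nsq_eq0 => /eqP -> /eqP ->.
  by exists (\pi_(imploded cov) (framed 1%g 0));
    rewrite spinor_pi /framed_spinor enorm_framed // sqrtr0 mul0r.
have h : nsq ((Num.sqrt t)^-1%:C * p) + nsq ((Num.sqrt t)^-1%:C * q) = 1.
  by rewrite !nsqM !nsq_real -mulrDr exprVn sqr_sqrtr // mulVf.
have sn : (Num.sqrt t)%:C * (Num.sqrt t)^-1%:C = 1 :> C.
  by rewrite -rmorphM /= mulfV // sqrtr_eq0 -ltNge lt_neqAle eq_sym tn.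
by exists (\pi_(imploded cov) (framed (su2_of h) t));
  rewrite spinor_pi /framed_spinor enorm_framed //
  ?su2_of00 ?su2_of10 mulrA sn mul1r.
Qed.

Lemma frame_continuous : continuous (@frame R cov).
Proof.
move=> x; apply: (@continuous_comp _ (SU2 R * 'cV[R]_3)%type _ set_val fst).
  exact: set_val_continuous.
exact: cvg_fst.
Qed.

Lemma vec_continuous : continuous (@vec R cov).
Proof.
move=> x; apply: (@continuous_comp _ (SU2 R * 'cV[R]_3)%type _ set_val snd).
  exact: set_val_continuous.
exact: cvg_snd.
Qed.

Lemma edge_continuous : continuous (@edge R cov).
Proof.
apply/quotient_continuous; rewrite (_ : _ \o _ = @vec R cov).
  exact: vec_continuous.
by apply/funext => x /=; exact: edge_pi.
Qed.

Lemma spinor_continuous i : continuous (spinor i).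
Proof.
apply/quotient_continuous; rewrite (_ : _ \o _ = framed_spinor i); last first.
  by apply/funext => x /=; exact: spinor_pi.
apply: cplx_continuousM.
  apply: realc_continuous => x.
  apply: (@continuous_comp _ _ _ (fun x => enorm (vec x)) Num.sqrt);
    last exact: sqrt_continuous.
  by apply: (@continuous_comp _ _ _ (@vec R cov) (@enorm R));
    [exact: vec_continuous | exact: enorm_continuous].
move=> x; apply: (@continuous_comp _ _ _ (@frame R cov) (fun F => su2_mx F i 0)).
  exact: frame_continuous.
exact: su2_entry_continuous.
Qed.

(** This ball is the image of the compact set SU(2) x [0, r] under the
    map [framed]. *)
Lemma imploded_compact (r : R) : compact [set z : imploded cov | enorm (edge z) <= r].
Proof.
pose f (Ft : SU2 R * R) : imploded cov := \pi_(imploded cov) (framed Ft.1 Ft.2).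
rewrite (_ : [set z : imploded cov | _] = f @` ([set: SU2 R] `*` `[0, r]%classic)).
  apply: continuous_compact; last first.
    by apply: compact_setX; [exact: su2_compact | exact: segment_compact].
  apply: continuous_subspaceT => Ft.
  apply: (@continuous_comp _ _ _ (fun Ft : SU2 R * R => framed Ft.1 Ft.2)
    \pi_(imploded cov)).
    exact: framed_continuous.
  exact: pi_continuous.
apply/seteqP; split => [z /=|_ [[F t] [_ /=]] + <-].
  elim/quotW: z => x; rewrite edge_pi => xr.
  exists (frame x, enorm (vec x)); last by rewrite /f framedK.
  by split => //=; rewrite in_itv /= enorm_ge0.
by rewrite in_itv /= => /andP[t0 tr]; rewrite edge_pi enorm_framed.
Qed.

(** The right-hand side involves the spinors only: all double coverings allowed
    by the hypotheses give the same scalar products. *)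
Lemma edge_dot z z' : ((edge z)^T *m edge z') 0 0 =
  2 * nsq ((spinor 0 z)^*%C * spinor 0 z' + (spinor 1 z)^*%C * spinor 1 z') -
  (nsq (spinor 0 z) + nsq (spinor 1 z)) * (nsq (spinor 0 z') + nsq (spinor 1 z')).
Proof.
rewrite !spinor_norm; elim/quotW: z => x; elim/quotW: z' => y.
rewrite !spinor_pi !edge_pi /framed_spinor.
set s := enorm (vec x); set t := enorm (vec y).
rewrite vecE [vec y]vecE -/s -/t [(s *: _)^T]linearZ /= -scalemxAl -scalemxAr.
have cJ (r : R) (w : C) : (r%:C * w)^*%C = r%:C * w^*%C.
  by apply: complex_ext; rewrite !cE /=; ring.
rewrite mxE [in X in _ * X]mxE rot_eps1_dot !cJ.
set a := su2_mx _ _ _; set b := su2_mx _ _ _.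
set c := su2_mx _ _ _; set d := su2_mx _ _ _.
rewrite [X in s * _ = 2 * nsq X - _](_ : _ = (Num.sqrt s)%:C *
  ((Num.sqrt t)%:C * (a^*%C * b + c^*%C * d))); last by ring.
rewrite !nsqM !nsq_real !sqr_sqrtr ?enorm_ge0 //; ring.
Qed.

Lemma spinor_imp_act i F z : spinor i (imp_act F z) =
  su2_mx F i 0 * spinor 0 z + su2_mx F i 1 * spinor 1 z.
Proof.
elim/quotW: z => x; rewrite imp_act_pi !spinor_pi /framed_spinor.
by rewrite vec_spin_act enorm_so3 frame_spin_act su2_mxM mxE sum2; ring.
Qed.

Lemma spinor_imp_frame_act i (t : torus R) z :
  spinor i (imp_frame_act t z) = su2_mx (\val t) 0 0 * spinor i z.
Proof.
elim/quotW: z => x; rewrite imp_frame_act_pi !spinor_pi /framed_spinor.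
rewrite vec_frame_act frame_frame_act su2_mxM mxE sum2.
by have /torus_iff -> := torusP t; rewrite mulr0 addr0; ring.
Qed.

End Spinor.

(** * Balanced pairs of rows *)

Section Hopf.
Variable R : realType.
Local Notation C := R[i].

(** The Hopf map from C^2 to R^3, normalized so that the length of the image is
    the squared norm of the spinor. *)
Definition hopf (p q : C) : 'cV[R]_3 :=
  \col_i [:: nsq p - nsq q; 2 * Re (p * q^*%C); 2 * Im (p * q^*%C)]`_i.

Lemma hopf_dot p q p' q' : ((hopf p q)^T *m hopf p' q') 0 0 =
  2 * nsq (p^*%C * p' + q^*%C * q') - (nsq p + nsq q) * (nsq p' + nsq q').
Proof. by rewrite mxE sum3 !mxE /= /nsq !cE; ring. Qed.

(** The squared length of a sum is the sum of the entries of the Gram matrix. *)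
Lemma gram_sum_eq0 n (x y : 'I_n -> 'cV[R]_3) :
  (forall i j, ((x i)^T *m x j) 0 0 = ((y i)^T *m y j) 0 0) ->
  \sum_i x i = 0 -> \sum_i y i = 0.
Proof.
have dotE (z : 'I_n -> 'cV[R]_3) : enorm (\sum_i z i) ^+ 2 =
    \sum_i \sum_j ((z i)^T *m z j) 0 0.
  rewrite enorm_sqr [(\sum_i z i)^T]raddf_sum mulmx_suml summxE.
  by apply: eq_bigr => i _; rewrite mulmx_sumr summxE.
move=> xy x0; apply/eqP; rewrite -enorm_eq0 -sqrf_eq0 dotE.
under eq_bigr do under eq_bigr do rewrite -xy.
by rewrite -dotE x0 sqrf_eq0 enorm_eq0.
Qed.

End Hopf.

Lemma double_sum_quadratic (S : comNzRingType) m (f g a b : 'I_m -> S) :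
  \sum_i \sum_j (f i * g j + f j * g i - 2 * (a i * a j + b i * b j)) =
  2 * ((\sum_i f i) * (\sum_i g i) - ((\sum_i a i) ^+ 2 + (\sum_i b i) ^+ 2)).
Proof.
set F := \sum_i f i; set G := \sum_i g i; set A := \sum_i a i; set B := \sum_i b i.
transitivity (\sum_i (f i * G + F * g i - 2 * (a i * A + b i * B))).
  apply: eq_bigr => i _; rewrite sumrB big_split /=.
  by rewrite -mulr_sumr -mulr_suml -mulr_sumr big_split /= -!mulr_sumr.
rewrite sumrB big_split /= -mulr_suml -mulr_sumr -mulr_sumr big_split /=.
by rewrite -!mulr_suml -/F -/G -/A -/B; ring.
Qed.

Section Balanced.
Variables (R : realType) (n : nat).
Local Notation C := R[i].
Implicit Types (u v : 'rV[C]_n) (w : 'M[C]_n).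

Definition rnorm u : R := \sum_i nsq (u 0 i).
Definition hdot u v : C := \sum_i u 0 i * (v 0 i)^*%C.
Definition wnorm w : R := \sum_i \sum_j nsq (w i j).

Definition balanced u v := rnorm u = rnorm v /\ hdot u v = 0.

Lemma rnorm_ge0 u : 0 <= rnorm u.
Proof. by apply: sumr_ge0 => i _; exact: nsq_ge0. Qed.

Lemma rnorm_eq0 u : rnorm u = 0 -> u = 0.
Proof.
move=> /eqP; rewrite psumr_eq0 => [/allP h|i _]; last exact: nsq_ge0.
apply/rowP => i; rewrite mxE; apply/eqP; rewrite -nsq_eq0.
by have := h i; rewrite mem_index_enum; exact.
Qed.

Lemma hdot_self u : hdot u u = (rnorm u)%:C.
Proof. by rewrite rmorph_sum; apply: eq_bigr => i _; rewrite mulCJ. Qed.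

Lemma rnormZ (a : C) u : rnorm (a *: u) = nsq a * rnorm u.
Proof. by rewrite mulr_sumr; apply: eq_bigr => i _; rewrite mxE nsqM. Qed.

Lemma hdotDl u u' v : hdot (u + u') v = hdot u v + hdot u' v.
Proof. by rewrite -big_split; apply: eq_bigr => i _; rewrite mxE mulrDl. Qed.

Lemma hdotZl (a : C) u v : hdot (a *: u) v = a * hdot u v.
Proof. by rewrite mulr_sumr; apply: eq_bigr => i _; rewrite mxE mulrA. Qed.

Lemma hdotC u v : hdot v u = (hdot u v)^*%C.
Proof.
rewrite [RHS]rmorph_sum; apply: eq_bigr => i _.
by rewrite [RHS]rmorphM /= mulrC; congr (_ * _); rewrite [RHS]conjcK.
Qed.

Lemma hdot_comb (a b c d : C) u v : balanced u v ->
  hdot (a *: u + b *: v) (c *: u + d *: v) =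
  (a * c^*%C + b * d^*%C) * (rnorm u)%:C.
Proof.
move=> [uv h0].
have vu0 : hdot v u = 0 by rewrite hdotC h0 conjc0.
have cj x y : (x * y)^*%C = x^*%C * y^*%C :> C.
  by apply: complex_ext; rewrite !cE; ring.
rewrite hdotDl !hdotZl [hdot u (_ + _)]hdotC [hdot v (_ + _)]hdotC.
rewrite !hdotDl !hdotZl h0 vu0 !mulr0 addr0 add0r !hdot_self -uv !cj conjc_real.
by ring.
Qed.

Lemma hdot_sum_re u v : Re (hdot u v) = \sum_i Re (u 0 i * (v 0 i)^*%C).
Proof. exact: (raddf_sum (@complex.Re R)). Qed.

Lemma hdot_sum_im u v : Im (hdot u v) = \sum_i Im (u 0 i * (v 0 i)^*%C).
Proof. exact: (raddf_sum (@complex.Im R)). Qed.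

(** Lagrange's identity; the factor 2 counts each Pluecker coordinate twice,
    since [wnorm] sums over all entries of the alternating matrix. *)
Lemma wnorm_wedge u v :
  wnorm (wedge u v) = 2 * (rnorm u * rnorm v - nsq (hdot u v)).
Proof.
rewrite /nsq hdot_sum_re hdot_sum_im /rnorm -double_sum_quadratic.
by do 2![apply: eq_bigr => ? _]; rewrite wedgeE /nsq !cE; ring.
Qed.

Lemma wnorm_balanced u v : balanced u v -> wnorm (wedge u v) = 2 * rnorm u ^+ 2.
Proof. by move=> [uv h0]; rewrite wnorm_wedge -uv h0 nsq0 subr0 expr2. Qed.

Lemma wnorm_ge0 w : 0 <= wnorm w.
Proof. by do 2![apply: sumr_ge0 => ? _]; exact: nsq_ge0. Qed.

Lemma wnorm_eq0 w : (wnorm w == 0) = (w == 0).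
Proof.
apply/eqP/eqP => [/eqP|->]; last first.
  by rewrite /wnorm big1 // => i _; rewrite big1 // => j _; rewrite mxE nsq0.
rewrite psumr_eq0 => [/allP h|i _]; last by apply: sumr_ge0 => j _; exact: nsq_ge0.
apply/matrixP => i j; rewrite mxE; apply/eqP; rewrite -nsq_eq0.
have /= := h i; rewrite mem_index_enum => /(_ isT).
rewrite psumr_eq0 => [/allP h'|k _]; last exact: nsq_ge0.
by have /= := h' j; rewrite mem_index_enum; exact.
Qed.

Lemma wnormZ (a : C) w : wnorm (a *: w) = nsq a * wnorm w.
Proof.
rewrite mulr_sumr; apply: eq_bigr => i _; rewrite mulr_sumr.
by apply: eq_bigr => j _; rewrite mxE nsqM.
Qed.

Lemma wnorm_continuous : continuous wnorm.
Proof.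
apply: continuous_sum => i; apply: continuous_sum => j M.
apply: (@continuous_comp _ _ _ (fun M : 'M[C]_n => M i j) (@nsq R)).
  exact: continuous_entry.
exact: nsq_continuous.
Qed.

Lemma mem_span2 u v u' : u' \in <<[:: u; v]>>%VS -> exists a b, u' = a *: u + b *: v.
Proof.
rewrite span_cons span_seq1 => /memv_addP[_ /vlineP[a ->]].
by move=> [_ /vlineP[b ->] ->]; exists a, b.
Qed.

Lemma wedge_eq_comb u v u' v' : wedge u v != 0 -> wedge u v = wedge u' v' ->
  exists a b c d : C, [/\ u' = a *: u + b *: v, v' = c *: u + d *: v &
    a * d - b * c = 1].
Proof.
move=> w0 ww'.
have sub : (<<[:: u'; v']>> <= <<[:: u; v]>>)%VS by apply: wedge_span; rewrite -?ww'.
have mem x : x \in [:: u'; v'] -> x \in <<[:: u; v]>>%VS.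
  by move=> xs; apply: (subvP sub); exact: memv_span.
have [|a [b ub]] := mem_span2 (mem u' _); first by rewrite !inE eqxx.
have [|c [d vb]] := mem_span2 (mem v' _); first by rewrite !inE eqxx orbT.
exists a, b, c, d; split => //.
move: ww'; rewrite ub vb wedge_comb -[LHS]scale1r => /eqP.
rewrite -subr_eq0 -scalerBl scaler_eq0 (negPf w0) orbF subr_eq0.
by move/eqP.
Qed.

Lemma wedge0l v : wedge 0 v = 0 :> 'M[C]_n.
Proof. by apply/matrixP => i j; rewrite wedgeE !mxE !mul0r subrr. Qed.

Lemma wedge0r u : wedge u 0 = 0 :> 'M[C]_n.
Proof. by apply/matrixP => i j; rewrite wedgeE !mxE !mulr0 subrr. Qed.

Lemma wedgeZl (a : C) u v : wedge (a *: u) v = a *: wedge u v.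
Proof. by apply/matrixP => i j; rewrite wedgeE [RHS]mxE wedgeE !mxE; ring. Qed.

(** The equality of bivectors provides a matrix of determinant 1 from one pair
    to the other.  It multiplies the common Gram matrix, which is scalar and
    the same for both pairs by [wnorm_balanced], so it is unitary. *)
Lemma balanced_unique u v u' v' : balanced u v -> balanced u' v' ->
  wedge u v = wedge u' v' -> exists F : SU2 R,
    u' = su2_mx F 0 0 *: u + su2_mx F 0 1 *: v /\
    v' = su2_mx F 1 0 *: u + su2_mx F 1 1 *: v.
Proof.
move=> B B' ww'.
have NN' : rnorm u = rnorm u'.
  have := congr1 wnorm ww'; rewrite !wnorm_balanced // => /(mulfI _).
  rewrite pnatr_eq0 => /(_ isT)/eqP; rewrite eqrXn2 ?rnorm_ge0 //.
  by move/eqP.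
have [w0|w0] := eqVneq (wedge u v) 0.
  have N0 : rnorm u = 0.
    have := wnorm_balanced B; rewrite w0.
    have /eqP -> : wnorm 0 == 0 by rewrite wnorm_eq0.
    move=> /esym/eqP; rewrite mulf_eq0 pnatr_eq0 sqrf_eq0 /= => /eqP //.
  have u0 := rnorm_eq0 N0; have u'0 := rnorm_eq0 (etrans (esym NN') N0).
  have v0 := rnorm_eq0 (etrans (esym B.1) N0).
  have v'0 := rnorm_eq0 (etrans (esym B'.1) (etrans (esym NN') N0)).
  by exists 1%g; rewrite u0 v0 u'0 v'0 !scaler0 addr0.
have N0 : (rnorm u)%:C != 0 :> C.
  rewrite (inj_eq (@complexI R)); apply: contraNneq w0 => /rnorm_eq0 ->.
  by rewrite wedge0l.
have [a [b [c [d [ub vb adbc]]]]] := wedge_eq_comb w0 ww'.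
have h1 : a * a^*%C + b * b^*%C = 1.
  by apply: (mulIf N0); rewrite -(hdot_comb a b a b B) -ub hdot_self NN' mul1r.
have h2 : c * c^*%C + d * d^*%C = 1.
  by apply: (mulIf N0); rewrite -(hdot_comb c d c d B) -vb hdot_self -B'.1 NN' mul1r.
have h3 : a * c^*%C + b * d^*%C = 0.
  by apply: (mulIf N0); rewrite -(hdot_comb a b c d B) -ub -vb B'.2 mul0r.
pose M : 'M[C]_2 := \matrix_(i, j)
  (if i == 0 then (if j == 0 then a else b) else (if j == 0 then c else d)).
have MS : SU2_set M.
  split; last by rewrite det2 !mxE.
  apply/unitarymxP/matrixP => i j; rewrite !mxE sum2 !mxE.
  have [->|->] := ord2P i; have [->|->] := ord2P j; rewrite /= ?h1 ?h2 ?h3 //.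
  have := congr1 (@conjc R) h3.
  by move=> h3'; rewrite -[RHS]conjc0 -h3'; apply: complex_ext; rewrite !cE; ring.
by exists (mk_su2 MS); rewrite /su2_mx /= !mxE.
Qed.

(** Gram-Schmidt makes [v] orthogonal to [u]; scaling the two rows by inverse
    factors then equalizes their norms without changing the bivector. *)
Lemma balanced_exists u v : exists u' v', balanced u' v' /\ wedge u v = wedge u' v'.
Proof.
have [w0|w0] := eqVneq (wedge u v) 0.
  exists 0, 0; rewrite w0 wedge0l; split => //; split => //.
  by rewrite /hdot big1 // => i _; rewrite mxE mul0r.
have N0 : (rnorm u)%:C != 0 :> C.
  rewrite (inj_eq (@complexI R)); apply: contraNneq w0 => /rnorm_eq0 ->.
  by rewrite wedge0l.
pose k := hdot v u / (rnorm u)%:C.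
pose v1 := - k *: u + v.
have w1 : wedge u v1 = wedge u v.
  have := wedge_comb 1 0 (- k) 1 u v.
  by rewrite !scale1r scale0r addr0 mulr1 mul0r subr0 scale1r.
have o1 : hdot v1 u = 0.
  by rewrite hdotDl hdotZl hdot_self /k mulNr divfK // addNr.
have Nu : 0 < rnorm u.
  by rewrite lt_neqAle rnorm_ge0 eq_sym andbT; move: N0; rewrite (inj_eq (@complexI R)).
have Nv : 0 < rnorm v1.
  rewrite lt_neqAle rnorm_ge0 eq_sym andbT; apply: contraNneq w0 => /rnorm_eq0 v10.
  by rewrite -w1 v10 wedge0r.
(* the scaling factor [s] must satisfy [s^2 |u|^2 = s^-2 |v1|^2] *)
pose r := Num.sqrt (rnorm v1 / rnorm u).
have r0 : 0 < r by rewrite sqrtr_gt0 divr_gt0.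
pose s := Num.sqrt r.
have s0 : s != 0 by rewrite gt_eqF // sqrtr_gt0.
have s2 : s ^+ 2 = r by rewrite sqr_sqrtr // ltW.
have r2 : r ^+ 2 = rnorm v1 / rnorm u by rewrite sqr_sqrtr // ltW // divr_gt0.
exists (s%:C *: u), (s^-1%:C *: v1); split.
  split; last by rewrite hdotZl hdotC hdotZl o1 mulr0 conjc0 mulr0.
  rewrite !rnormZ !nsq_real exprVn s2.
  have rn0 : r != 0 by rewrite gt_eqF.
  apply: (mulfI rn0); rewrite mulrA -expr2 r2 mulrA mulfV ?gt_eqF //.
  by rewrite mul1r divfK // gt_eqF.
have := wedge_comb s%:C 0 0 s^-1%:C u v1.
by rewrite !scale0r addr0 add0r mul0r subr0 -rmorphM /= mulfV // scale1r w1.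
Qed.

End Balanced.

(** * The homeomorphism from polygons to the affine cone *)

Section PolygonCoordinates.
Variables (R : realType) (cov : spin_cover R) (n : nat).
Local Notation C := R[i].
Implicit Types (z : Ptilde cov n) (p : Pn cov n).

Definition spinor_row (k : 'I_2) (y : 'I_n -> imploded cov) : 'rV[C]_n :=
  \row_i spinor k (y i).

(** The sides and the Hopf vectors of their spinors have the same Gram matrix,
    so one sum vanishes if and only if the other one does; the sum of the Hopf
    vectors has the coordinates [|u|^2 - |v|^2] and [2 <u, v>]. *)
Lemma closedP (y : 'I_n -> imploded cov) :
  \sum_i edge (y i) = 0 <-> balanced (spinor_row 0 y) (spinor_row 1 y).
Proof.
set u := spinor_row 0 y; set v := spinor_row 1 y.
have dots i j : ((edge (y i))^T *m edge (y j)) 0 0 =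
    ((hopf (u 0 i) (v 0 i))^T *m hopf (u 0 j) (v 0 j)) 0 0.
  by rewrite edge_dot hopf_dot !mxE.
transitivity (\sum_i hopf (u 0 i) (v 0 i) = 0).
  by split; apply: gram_sum_eq0 => i j; rewrite dots.
have E k : (\sum_i hopf (u 0 i) (v 0 i)) k 0 =
    [:: rnorm u - rnorm v; 2 * Re (hdot u v); 2 * Im (hdot u v)]`_k.
  rewrite summxE; under eq_bigr do rewrite mxE.
  have [->|->|->] := ord3P k; rewrite /=.
  - by rewrite sumrB.
  - by rewrite -mulr_sumr hdot_sum_re.
  - by rewrite -mulr_sumr hdot_sum_im.
split=> [h|[uv h0]].
  have H k := congr1 (fun M : 'cV[R]_3 => M k 0) h.
  have := H 0; have := H 1; have := H 2%:R; rewrite !E !mxE /= => h2 h1 h0.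
  by split; [lra | apply: complex_ext; rewrite !cE; lra].
apply/matrixP => k j; rewrite ord1 E mxE uv h0 subrr !cE mulr0.
by have [->|->|->] := ord3P k.
Qed.

Definition urow z : 'rV[C]_n := spinor_row 0 (side z).
Definition vrow z : 'rV[C]_n := spinor_row 1 (side z).

Lemma poly_balanced z : balanced (urow z) (vrow z).
Proof. by apply/closedP; exact: PtildeP. Qed.

Lemma perimeterE z : poly_perimeter z = 2 * rnorm (urow z).
Proof.
have [uv _] := poly_balanced z.
rewrite mulr2n mulrDl mul1r {2}uv -big_split; apply: eq_bigr => i _.
by rewrite /= !mxE spinor_norm.
Qed.

Lemma perimeter_wnorm z : poly_perimeter z ^+ 2 = 2 * wnorm (wedge (urow z) (vrow z)).
Proof. by rewrite (wnorm_balanced (poly_balanced z)) perimeterE; ring. Qed.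

Lemma row_poly_act (F : SU2 R) z :
  urow (poly_act F z) = su2_mx F 0 0 *: urow z + su2_mx F 0 1 *: vrow z /\
  vrow (poly_act F z) = su2_mx F 1 0 *: urow z + su2_mx F 1 1 *: vrow z.
Proof. by split; apply/rowP => i; rewrite !mxE -spinor_imp_act. Qed.

Lemma su2_det F : su2_mx F 0 0 * su2_mx F 1 1 - su2_mx F 0 1 * su2_mx F 1 0 = 1 :> C.
Proof. by have [_] := su2P F; rewrite det2. Qed.

Lemma wedge_poly_act (F : SU2 R) z :
  wedge (urow (poly_act F z)) (vrow (poly_act F z)) = wedge (urow z) (vrow z).
Proof.
have [-> ->] := row_poly_act F z.
by rewrite wedge_comb su2_det scale1r.
Qed.

Lemma row_inj y z : urow y = urow z -> vrow y = vrow z -> y = z.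
Proof.
move=> /rowP hu /rowP hv; apply: side_inj => i; apply: spinor_inj.
  by have := hu i; rewrite !mxE.
by have := hv i; rewrite !mxE.
Qed.

Lemma plucker_subproof z : AffGr2 R n (wedge (urow z) (vrow z)).
Proof. by exists (urow z), (vrow z). Qed.

Definition bivector p : AffGr2 R n := set_elt (plucker_subproof (repr p)).

(** The action multiplies the bivector by the determinant of an element of
    SU(2). *)
Lemma bivector_pi z : \val (bivector (\pi_(Pn cov n) z)) = wedge (urow z) (vrow z).
Proof.
have /eqP/Pn_eqP[F zF] := reprK (\pi_(Pn cov n) z).
by rewrite /bivector /= [in RHS]zF wedge_poly_act.
Qed.

Lemma bivector_inj : injective bivector.
Proof.
move=> p q; elim/quotW: p => y; elim/quotW: q => z /(congr1 \val).
rewrite !bivector_pi => /(balanced_unique (poly_balanced y) (poly_balanced z)).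
move=> [F [uF vF]]; apply/eqP/Pn_eqP; exists F.
by have [uE vE] := row_poly_act F y; apply: row_inj; rewrite ?uE ?vE.
Qed.

Lemma bivector_surj w : exists p, bivector p = w.
Proof.
have : AffGr2 R n (\val w) by have := valP w; rewrite inE.
move=> [u [v wuv]]; have [u' [v' [B uv]]] := balanced_exists u v.
have lift i : {y : imploded cov | spinor 0 y = u' 0 i /\ spinor 1 y = v' 0 i}.
  by apply: cid; have [y y0 y1] := spinor_surj cov (u' 0 i) (v' 0 i); exists y.
pose y i := sval (lift i).
have ru : spinor_row 0 y = u'.
  by apply/rowP => i; rewrite mxE; have [] := svalP (lift i).
have rv : spinor_row 1 y = v'.
  by apply/rowP => i; rewrite mxE; have [] := svalP (lift i).
have yP : Ptilde cov n y by apply/closedP; rewrite ru rv.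
exists (\pi_(Pn cov n) (set_elt yP)); apply: val_inj; rewrite bivector_pi.
by rewrite wuv uv -ru -rv.
Qed.

Lemma side_continuous i : continuous (fun z => side z i).
Proof.
move=> z; apply: (@continuous_comp _ {ptws 'I_n -> imploded cov} _ set_val (fun f => f i)).
  exact: set_val_continuous.
exact: eval_continuous.
Qed.

Lemma spinor_side_continuous k i : continuous (fun z => spinor k (side z i)).
Proof.
move=> z; apply: (@continuous_comp _ _ _ (fun z => side z i) (spinor k)).
  exact: side_continuous.
exact: spinor_continuous.
Qed.

Lemma bivector_continuous : continuous bivector.
Proof.
apply/quotient_continuous.
apply: (@continuous_set_type _ 'M[C]_n (AffGr2 R n)).
have -> : (fun x => set_val ((bivector \o \pi_(Pn cov n)) x)) =
    (fun z => wedge (urow z) (vrow z)) by apply/funext => z; exact: bivector_pi.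
apply: continuous_mx => i j.
have -> : (fun z => wedge (urow z) (vrow z) i j) = (fun z =>
    spinor 0 (side z i) * spinor 1 (side z j) + - (spinor 0 (side z j) * spinor 1 (side z i))).
  by apply/funext => z; rewrite wedgeE !mxE.
apply: cplx_continuousD; last apply: cplx_continuousN;
  by apply: cplx_continuousM; exact: spinor_side_continuous.
Qed.

Lemma poly_perimeter_continuous : continuous (@poly_perimeter R cov n).
Proof.
apply: continuous_sum => i z.
apply: (@continuous_comp _ _ _ (fun z => edge (side z i)) (@enorm R));
  last exact: enorm_continuous.
apply: (@continuous_comp _ _ _ (fun z => side z i) (@edge R cov));
  last exact: edge_continuous.
exact: side_continuous.
Qed.

Lemma perimeter_continuous : continuous (@perimeter R cov n).
Proof.
apply/quotient_continuous.
have -> : @perimeter R cov n \o \pi_(Pn cov n) = @poly_perimeter R cov n.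
  by apply/funext => z; exact: perimeter_pi.
exact: poly_perimeter_continuous.
Qed.

Lemma Ptilde_closed : closed (Ptilde cov n).
Proof.
pose f (y : {ptws 'I_n -> imploded cov}) : 'cV[R]_3 := \sum_i edge (y i).
suff fc : continuous f.
  rewrite (_ : Ptilde cov n = f @^-1` [set 0]) //.
  apply: closed_comp; first by move=> y _; exact: fc.
  apply: compact_closed; last exact: compact_set1.
  exact: mx_hausdorff (@Rhausdorff R).
apply: continuous_sum => i y.
apply: (@continuous_comp {ptws 'I_n -> imploded cov} _ _ (fun y => y i) (@edge R cov));
  last exact: edge_continuous.
exact: eval_continuous.
Qed.

Lemma perimeter_bounded_compact (r : R) :
  exists2 K : set (Pn cov n), compact K & [set p | perimeter p <= r] `<=` K.
Proof.
pose B : set {ptws 'I_n -> imploded cov} := [set y | forall i, enorm (edge (y i)) <= r].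
pose K : set (Ptilde cov n) := [set z | B (\val z)].
exists (\pi_(Pn cov n) @` K).
  apply: continuous_compact.
    by apply: continuous_subspaceT; exact: pi_continuous.
  apply: compact_set_type; rewrite (_ : _ @` _ = B `&` Ptilde cov n).
    apply: compact_closedI; last exact: Ptilde_closed.
    exact: compact_ptws (@imploded_compact R cov r).
  apply/seteqP; split => [_ [z Kz <-]|y [By Py]].
    by split => //; exact: set_valP.
  by exists (set_elt Py).
move=> p; elim/quotW: p => z; rewrite /= perimeter_pi => zr.
exists z => // i; apply: le_trans zr.
rewrite /poly_perimeter (bigD1 i) //= lerDl sumr_ge0 // => j _.
exact: enorm_ge0.
Qed.

(** Bounded bivectors come from polygons of bounded perimeter, which lie in a
    compact set. *)
Lemma bivector_homeo : homeomorphism bivector.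
Proof.
apply: homeomorphism_proper.
- exact: bivector_continuous.
- exact: bivector_inj.
- exact: bivector_surj.
- by apply: set_type_hausdorff; apply: mx_hausdorff; exact: complex_hausdorff.
move=> w; pose m := wnorm (\val w) + 1.
have wc : continuous (fun w : AffGr2 R n => wnorm (\val w)).
  move=> x; apply: (@continuous_comp _ 'M[C]_n _ set_val (@wnorm R n)).
    exact: set_val_continuous.
  exact: wnorm_continuous.
exists [set x : AffGr2 R n | wnorm (\val x) < m].
  apply: (wc w [set t | t < m]); apply: open_nbhs_nbhs; split; first exact: open_lt.
  by rewrite /= /m ltrDl.
(* [perimeter ^ 2 = 2 wnorm < 2 m], and [2 m <= (2 m) ^ 2] because [1 <= m] *)
have [K cK PK] := perimeter_bounded_compact (2 * m).
exists K => // p pm; apply: PK; move: p pm; elim/quotW => z zm; move: zm.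
rewrite /= perimeter_pi => zm.
have {}zm : wnorm (\val (bivector (\pi_(Pn cov n) z))) < m by exact: zm.
rewrite bivector_pi in zm.
have := perimeter_wnorm z; have m1 : 1 <= m by rewrite lerDr wnorm_ge0.
by move=> h; nra.
Qed.

End PolygonCoordinates.

(** * The Grassmannian is a Hausdorff space *)

Section ProjectiveSpace.
Variables (R : realType) (n : nat).
Local Notation C := R[i].
Implicit Types (u v : 'rV[C]_n) (w : 'M[C]_n).

(** By [wnorm_wedge] this measures the angle between the lines of [w] and [w0];
    it is invariant under scaling of [w] and vanishes exactly when the lines
    coincide, so it separates points of the projective space. *)
Definition cross w0 w : R := wnorm (wedge (mxvec w) (mxvec w0)) / wnorm w.

Lemma crossZ w0 w (c : C) : c != 0 -> cross w0 (c *: w) = cross w0 w.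
Proof.
move=> c0; rewrite /cross linearZ /=.
rewrite wedgeZl.
by rewrite !wnormZ -mulf_div mulfV ?nsq_eq0 // mul1r.
Qed.

Lemma cross_self w : cross w w = 0.
Proof.
have ww : wedge (mxvec w) (mxvec w) = 0 by rewrite /wedge subrr.
by rewrite /cross ww (eqP (_ : wnorm 0 == 0)) ?wnorm_eq0 // mul0r.
Qed.

Lemma cross_eq0 w0 w : w0 != 0 -> w != 0 -> cross w0 w = 0 -> exists c, w = c *: w0.
Proof.
move=> w00 wn0 /eqP; rewrite mulf_eq0 invr_eq0 !wnorm_eq0 (negPf wn0) orbF.
rewrite -[_ == 0]negbK wedge_neq0 free_cons span_seq1 seq1_free.
rewrite mxvec_eq0 w00 andbT negbK => /vlineP[c cE]; exists c.
by apply: (can_inj mxvecK); rewrite linearZ.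
Qed.

Lemma ext2_star_neq0 (w : @ext2_star R n) : \val w != 0.
Proof. by have := valP w; rewrite inE => -[]. Qed.

Lemma cross_continuous w0 : continuous (fun w : @ext2_star R n => cross w0 (\val w)).
Proof.
have vc : continuous (fun w : @ext2_star R n => \val w).
  exact: (@set_val_continuous 'M[C]_n (@ext2_star R n)).
have mc k : continuous (fun w : @ext2_star R n => mxvec (\val w) 0 k).
  case/mxvec_indexP: k => i j; under eq_fun do rewrite mxvecE.
  move=> w; apply: (@continuous_comp _ _ _ (fun w : @ext2_star R n => \val w)
    (fun M : 'M[C]_n => M i j)).
    exact: vc.
  exact: continuous_entry.
have wc : continuous (fun w : @ext2_star R n => wedge (mxvec (\val w)) (mxvec w0)).
  apply: continuous_mx => i j; under eq_fun do rewrite wedgeE.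
  have cc k : continuous (fun w : @ext2_star R n => mxvec w0 0 k).
    exact: cst_continuous.
  exact: cplx_continuousD (cplx_continuousM (mc i) (cc j))
    (cplx_continuousN (cplx_continuousM (mc j) (cc i))).
have nc : continuous
    (fun w : @ext2_star R n => wnorm (wedge (mxvec (\val w)) (mxvec w0))).
  move=> w; exact: (continuous_comp (wc w) (@wnorm_continuous R _ _)).
have dc : continuous (fun w : @ext2_star R n => wnorm (\val w)).
  move=> w; exact: (continuous_comp (vc w) (@wnorm_continuous R _ _)).
move=> w; apply: (cvgM (nc w)); apply: (cvgV _ (dc w)).
by rewrite wnorm_eq0 ext2_star_neq0.
Qed.

Definition line_cross w0 (l : Pext2 R n) : R := cross w0 (\val (repr l)).

Lemma line_cross_pi w0 (w : @ext2_star R n) :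
  line_cross w0 (\pi_(Pext2 R n) w) = cross w0 (\val w).
Proof.
rewrite /line_cross; have := reprK (\pi_(Pext2 R n) w).
move=> /(@eqquotP _ _ {eq_quot (@line_equiv R n)})/asboolP[c c0 wE].
by rewrite [in RHS]wE crossZ.
Qed.

Lemma line_cross_continuous w0 : continuous (line_cross w0).
Proof.
apply/quotient_continuous.
rewrite (_ : _ \o _ = fun w : @ext2_star R n => cross w0 (\val w)).
  exact: cross_continuous.
by apply/funext => w; exact: line_cross_pi.
Qed.

Lemma wedge_scale_span u v u' v' (c : C) : wedge u v != 0 -> c != 0 ->
  wedge u' v' = c *: wedge u v -> <<[:: u; v]>>%VS = <<[:: u'; v']>>%VS.
Proof.
move=> w0 c0 wE.
have w'0 : wedge u' v' != 0 by rewrite wE scaler_eq0 negb_or c0.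
have sub a : (<<[:: a *: u; v]>> <= <<[:: u; v]>>)%VS.
  apply/span_subvP => x; rewrite !inE => /orP[] /eqP ->.
    by rewrite rpredZ // memv_span // !inE eqxx.
  by rewrite memv_span // !inE eqxx orbT.
have s1 : (<<[:: u'; v']>> <= <<[:: c *: u; v]>>)%VS.
  by apply: wedge_span; rewrite // wE wedgeZl.
have s2 : (<<[:: c *: u; v]>> <= <<[:: u'; v']>>)%VS.
  by apply: wedge_span; rewrite wedgeZl -wE.
apply: subv_anti; apply/andP; split; last exact: subv_trans s1 (sub c).
apply: subv_trans s2; apply/span_subvP => x; rewrite !inE => /orP[] /eqP ->.
  rewrite -[u](scalerK c0) rpredZ // memv_span // !inE scalerK //.
  by rewrite eqxx.
by rewrite memv_span // !inE eqxx orbT.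
Qed.

Lemma plane_span (W : @plane_set R n) :
  \val W = <<[:: plane_fst W; plane_snd W]>>%VS.
Proof. by rewrite -plane_basis; symmetry; apply: span_basis; exact: vbasisP. Qed.

(** The function [line_cross], taken at the bivector of one plane, separates
    that plane from every other one. *)
Lemma Gr2_hausdorff : hausdorff_space (Gr2 R n).
Proof.
apply: (hausdorff_separated (@Rhausdorff R)) => W W' WW'.
pose w0 := wedge (plane_fst W) (plane_snd W).
exists (fun X : Gr2 R n => line_cross w0 (plucker X)).
  move=> X; apply: (@continuous_comp (Gr2 R n) _ _ (@plucker R n) (line_cross w0)).
    exact: initial_continuous.
  exact: line_cross_continuous.
rewrite !line_cross_pi /= cross_self => /esym h; apply: WW'; apply: val_inj.
have [_ w00] := plane_ext2_star W; have [_ w10] := plane_ext2_star W'.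
have [c wE] := cross_eq0 w00 w10 h.
rewrite !plane_span; apply: (wedge_scale_span w00 _ wE).
by apply: contraNneq w10 => c0; rewrite wE c0 scale0r.
Qed.

End ProjectiveSpace.

(** * The induced homeomorphism onto the Grassmannian *)

Section GrassmannianHomeo.
Variables (R : realType) (cov : spin_cover R) (n : nat).
Local Notation C := R[i].
Implicit Types (p q : Pn1 cov n).

(** Both rows are multiplied by the diagonal entry of [t], whence the square. *)
Lemma bivector_torus (t : torus R) (p : Pn cov n) :
  \val (bivector (torus_act (fun=> t) p)) =
  su2_mx (\val t) 0 0 ^+ 2 *: \val (bivector p).
Proof.
elim/quotW: p => z; rewrite torus_act_pi !bivector_pi.
set a := su2_mx _ _ _.
have -> : urow (poly_torus (fun=> t) z) = a *: urow z + 0 *: vrow z.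
  by rewrite scale0r addr0; apply/rowP => i; rewrite !mxE -spinor_imp_frame_act.
have -> : vrow (poly_torus (fun=> t) z) = 0 *: urow z + a *: vrow z.
  by rewrite scale0r add0r; apply/rowP => i; rewrite !mxE -spinor_imp_frame_act.
by rewrite wedge_comb mul0r subr0.
Qed.

Lemma perimeter_bivector (p : Pn cov n) :
  perimeter p ^+ 2 = 2 * wnorm (\val (bivector p)).
Proof. by elim/quotW: p => z; rewrite bivector_pi perimeter_pi perimeter_wnorm. Qed.

Lemma perimeter_ge0 (p : Pn cov n) : 0 <= perimeter p.
Proof. by apply: sumr_ge0 => i _; exact: enorm_ge0. Qed.

Lemma Pn1_wnorm p : wnorm (\val (bivector (\val p))) = 2^-1.
Proof.
have p1 : perimeter (\val p) = 1 by have := valP p; rewrite inE.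
have := perimeter_bivector (\val p); rewrite p1 expr1n => h.
by apply: (@mulfI _ 2) => //; rewrite -h mulfV.
Qed.

Lemma AffGr2P (w : AffGr2 R n) : AffGr2 R n (\val w).
Proof. by have := valP w; rewrite inE. Qed.

Lemma Pn1_star_subproof p : AffGr2_star R n (\val (bivector (\val p))).
Proof.
split; first exact: AffGr2P.
by rewrite -wnorm_eq0 Pn1_wnorm invr_eq0.
Qed.

Definition star p : AffGr2_star R n := set_elt (Pn1_star_subproof p).

Definition polygon_plane p : Gr2 R n := cone_proj (star p).

Lemma cone_proj_eqP (w w' : AffGr2_star R n) :
  cone_proj w = cone_proj w' <-> exists2 c : C, c != 0 & \val w' = c *: \val w.
Proof.
have [[u v] wE0] := AffGr2_starP w; have [[u' v'] wE0'] := AffGr2_starP w'.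
have wE : \val w = wedge u v := wE0; have wE' : \val w' = wedge u' v' := wE0'.
have w0 := AffGr2_star_neq0 w; have w0' := AffGr2_star_neq0 w'.
split=> [ww'|[c c0 cE]].
  have : <<[:: u; v]>>%VS = <<[:: u'; v']>>%VS.
    by rewrite -(cone_projE wE) -(cone_projE wE') ww'.
  move=> ss.
  have mem x : x \in [:: u'; v'] -> x \in <<[:: u; v]>>%VS.
    by move=> xs; rewrite ss; exact: memv_span.
  have [|a [b uE]] := mem_span2 (mem u' _); first by rewrite !inE eqxx.
  have [|c [d vE]] := mem_span2 (mem v' _); first by rewrite !inE eqxx orbT.
  have E : \val w' = (a * d - b * c) *: \val w by rewrite wE' uE vE wedge_comb wE.
  by exists (a * d - b * c) => //; apply: contraNneq w0' => c0; rewrite E c0 scale0r.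
apply: val_inj.
rewrite -[LHS]/(plane_of (cone_proj w)) -[RHS]/(plane_of (cone_proj w')).
rewrite (cone_projE wE) (cone_projE wE'); apply: (@wedge_scale_span _ _ _ _ _ _ c) => //.
  by rewrite -wE.
by rewrite -wE -wE'.
Qed.

(** Two bivectors of perimeter 1 on the same line differ by a unit complex
    number, and such a number is the square of an entry of the torus. *)
Lemma polygon_plane_eqP p q :
  polygon_plane p = polygon_plane q <-> \pi_(Qn cov n) p = \pi_(Qn cov n) q.
Proof.
split=> [/cone_proj_eqP[c c0 /= cE]|].
  have c1 : nsq c = 1.
    have := congr1 (@wnorm R n) cE; rewrite wnormZ !Pn1_wnorm => h.
    by apply: (@mulIf _ 2^-1); rewrite ?invr_eq0 // mul1r -h.
  have [a a1 aa] := unit_sqrt c1.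
  have h : nsq a + nsq 0 = 1 by rewrite a1 nsq0 addr0.
  have ta : torus R (su2_of h) by apply/torus_iff; rewrite su2_of10.
  apply/(@eqquotP _ _ {eq_quot (@circle_equiv R cov n)})/asboolP; exists (set_elt ta).
  apply: bivector_inj; apply: val_inj.
  apply: (etrans _ (esym (bivector_torus (set_elt ta) (\val p)))).
  by rewrite su2_of00 expr2 aa; exact: cE.
move=> /(@eqquotP _ _ {eq_quot (@circle_equiv R cov n)})/asboolP[t qt].
apply/cone_proj_eqP; exists (su2_mx (\val t) 0 0 ^+ 2).
  rewrite sqrf_eq0 -nsq_eq0.
  have := su2_unit (\val t); have /torus_iff -> := torusP t.
  by rewrite nsq0 addr0 => ->; rewrite oner_eq0.
by have := bivector_torus t (\val p); rewrite -qt.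
Qed.

(** The bivector of a basis, scaled to perimeter 1, lifts to a polygon. *)
Lemma polygon_plane_surj (W : Gr2 R n) : exists p, polygon_plane p = W.
Proof.
set u := plane_fst W; set v := plane_snd W.
have [_ w0] := plane_ext2_star W; rewrite -/u -/v in w0.
have N0 : 0 < wnorm (wedge u v) by rewrite lt_neqAle wnorm_ge0 eq_sym wnorm_eq0 w0.
pose a : R := Num.sqrt (2 * wnorm (wedge u v))^-1.
have a2 : a ^+ 2 = (2 * wnorm (wedge u v))^-1.
  by rewrite sqr_sqrtr // invr_ge0 mulr_ge0 // ltW.
have a0 : a%:C != 0 :> C.
  by rewrite (inj_eq (@complexI R)) -sqrf_eq0 a2 invr_eq0 mulf_neq0 // gt_eqF.
have wP : AffGr2 R n (wedge (a%:C *: u) v) by exists (a%:C *: u), v.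
have [p pE] := bivector_surj cov (set_elt wP).
have p1 : Pn1 cov n p.
  apply/eqP; rewrite -(@eqrXn2 _ 2) ?perimeter_ge0 // perimeter_bivector pE /=.
  by rewrite wedgeZl wnormZ nsq_real a2 expr1n mulrCA mulVf // mulf_neq0 // gt_eqF.
exists (set_elt p1); apply: val_inj.
rewrite -[LHS]/(plane_of (cone_proj (star (set_elt p1)))).
rewrite (@cone_projE _ _ _ (a%:C *: u) v); last exact: (congr1 \val pE).
rewrite plane_span -/u -/v; symmetry.
by apply: (@wedge_scale_span _ _ _ _ _ _ a%:C) => //; exact: wedgeZl.
Qed.

Lemma polygon_plane_continuous : continuous polygon_plane.
Proof.
have extP p : @ext2_star R n (\val (bivector (\val p))).
  by have [/AffGr2_ext2 ? ?] := Pn1_star_subproof p.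
apply: continuous_comp_initial.
have -> : @plucker R n \o polygon_plane = \pi_(Pext2 R n) \o (fun p => set_elt (extP p)).
  apply/funext => p; have [[u v] wE0] := AffGr2_starP (star p).
  have wE : \val (star p) = wedge u v := wE0.
  exact: (@pluckerE _ _ (polygon_plane p) (set_elt (extP p)) u v (cone_projE wE) wE).
move=> p; apply: continuous_comp; last exact: pi_continuous.
move: p; apply: (@continuous_set_type _ 'M[C]_n (@ext2_star R n)) => p.
apply: (@continuous_comp _ _ _ (fun p : Pn1 cov n => bivector (\val p))
  (fun w : AffGr2 R n => \val w)).
  apply: (@continuous_comp _ _ _ (fun p : Pn1 cov n => \val p) (@bivector R cov n)).
    exact: (@set_val_continuous _ (Pn1 cov n)).
  exact: bivector_continuous.
exact: (@set_val_continuous 'M[C]_n (AffGr2 R n)).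
Qed.

Lemma Qn_compact : compact [set: Qn cov n].
Proof.
rewrite (_ : [set: _] = \pi_(Qn cov n) @` [set: Pn1 cov n]); last first.
  by apply/seteqP; split => // q _; exists (repr q) => //; exact: reprK.
apply: continuous_compact.
  by apply: continuous_subspaceT; exact: pi_continuous.
apply: compact_set_type.
have [K cK PK] := perimeter_bounded_compact cov n 1.
rewrite (_ : _ @` _ = K `&` Pn1 cov n).
  apply: compact_closedI => //.
  rewrite (_ : Pn1 cov n = @perimeter R cov n @^-1` [set 1]) //.
  apply: closed_comp; last exact: closed_eq.
  by move=> p _; exact: perimeter_continuous.
apply/seteqP; split => [_ [p _ <-]|p [_ p1]]; last by exists (set_elt p1).
have p1 : Pn1 cov n (\val p) by have := valP p; rewrite inE.
by split => //; apply: PK; rewrite /= p1.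
Qed.

Definition polygon_gr (q : Qn cov n) : Gr2 R n := polygon_plane (repr q).

Lemma polygon_gr_pi p : polygon_gr (\pi_(Qn cov n) p) = polygon_plane p.
Proof. by apply/polygon_plane_eqP; rewrite reprK. Qed.

(** A continuous bijection from a compact space to a Hausdorff space. *)
Lemma polygon_gr_homeo : homeomorphism polygon_gr.
Proof.
apply: homeomorphism_proper.
- apply/quotient_continuous; rewrite (_ : _ \o _ = polygon_plane).
    exact: polygon_plane_continuous.
  by apply/funext => p; exact: polygon_gr_pi.
- by move=> q q' /polygon_plane_eqP; rewrite !reprK.
- move=> W; have [p pW] := polygon_plane_surj W.
  by exists (\pi_(Qn cov n) p); rewrite polygon_gr_pi.
- exact: Gr2_hausdorff.
move=> W; exists setT; first exact: filterT.
by exists setT => //; exact: Qn_compact.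
Qed.

End GrassmannianHomeo.

Theorem theorem1p2 (R : realType) (cov : spin_cover R) (n : nat)
    (hn : (3 <= n)%N) :
  exists h : Pn cov n -> AffGr2 R n, homeomorphism h /\
  exists g : Qn cov n -> Gr2 R n, homeomorphism g /\
  forall p : Pn1 cov n, exists w : AffGr2_star R n,
    \val w = \val (h (\val p)) /\ g (\pi_(Qn cov n) p) = cone_proj w.
Proof.
exists (@bivector R cov n); split; first exact: bivector_homeo.
exists (@polygon_gr R cov n); split; first exact: polygon_gr_homeo.
by move=> p; exists (star p); split => //; exact: polygon_gr_pi.
Qed.
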